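(* There exists a constant $C > 0$ such that the following holds for all integers $s \ge 2$ and $n \ge s^C$. There exists a $K_{s+1}$-free graph $G$ with $n$ vertices such that, for every integer $k$ with $k \ge C s^3 \sqrt{n \log n}$, every set of $k$ vertices of $G$ contains a copy of $K_s$ (that is, $G[S] \supset K_s$ for every $S \subset V(G)$ with $|S| = k$).
   Context: $K_s$ denotes the complete graph on $s$ vertices, and $\log$ is the natural logarithm. *)

(* Defs.v *)
From mathcomp Require Import all_boot.

Set Implicit Arguments.
Unset Strict Implicit.
Unset Printing Implicit Defensive.

Record sgraph := SGraph {
  vertex :> finType;
  edge : rel vertex;
  edge_sym : symmetric edge;
  edge_irrefl : irreflexive edge }.

Section CompleteGraph.
Variable s : nat.

Definition complete_edge : rel 'I_s := fun x y => x != y.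

Lemma complete_edge_sym : symmetric complete_edge.
Proof. by move=> x y; rewrite /complete_edge eq_sym. Qed.

Lemma complete_edge_irrefl : irreflexive complete_edge.
Proof. by move=> x; rewrite /complete_edge eqxx. Qed.

Definition complete_graph : sgraph :=
  SGraph complete_edge_sym complete_edge_irrefl.

End CompleteGraph.

Section InducedGraph.
Variables (G : sgraph) (S : {set G}).

Definition induced_edge : rel {x : G | x \in S} :=
  fun x y => edge (val x) (val y).

Lemma induced_edge_sym : symmetric induced_edge.
Proof. by move=> x y; exact: edge_sym. Qed.

Lemma induced_edge_irrefl : irreflexive induced_edge.
Proof. by move=> x; exact: edge_irrefl. Qed.

Definition induced_subgraph : sgraph :=
  SGraph induced_edge_sym induced_edge_irrefl.

End InducedGraph.

(* G contains H as a (not necessarily induced) subgraph. *)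
Definition contains_copy (G H : sgraph) : Prop :=
  exists2 f : H -> G, injective f & forall x y : H, edge x y -> edge (f x) (f y).

Definition free_of (H G : sgraph) : Prop := ~ contains_copy G H.

(* Main.v *)
Require Import Defs.
From mathcomp Require Import all_boot all_order all_algebra.
From mathcomp Require Import all_classical all_reals all_analysis.
From mathcomp Require Import zify ring lra.

Set Implicit Arguments.
Unset Strict Implicit.
Unset Printing Implicit Defensive.

Import Order.TTheory GRing.Theory Num.Theory.
Local Open Scope ring_scope.

(** The graph is built from random complete s-partite pieces that are glued
    together so that every triangle lies inside a single piece.  Then a clique
    lies inside a single piece as well, so it has at most s vertices.

    There is a set B of M points, with M about n / r and r about n^(1/8), and a
    random block system on B: N blocks, where each point receives in each block
    an independent uniform label in {0, ..., L - 1}.  A point is present in the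
    block when its label is less than s, and then the label is its part.  In
    block l, two present points of distinct parts are joined unless they are at
    distance at most two through earlier blocks or one of them meets in block l
    a point with which it already shares an earlier block.  These deletions kill
    every triangle that uses two blocks ([triangle_one_block]).

    M is much smaller than n because in a graph on n vertices of the degree
    needed here nearly every pair has common neighbours, and the deletions
    would destroy everything.  On B the density of pairs at distance two is a
    negative power of n.  The n vertices are sent to B by two maps: one has
    intervals of length r as fibres, the other is random.  Each map pulls back
    its own block system, and an edge that comes from one side is kept only if
    its ends have distinct images at distance more than two on the other side.
    This kills the triangles that mix the two sides
    ([two_system_graph_free]).

    Let m be a suitable multiple of s^3 sqrt(n log n).  Any 16 m vertices have
    at least m images on one of the sides, since otherwise they would lie in a
    small grid, which the random map prevents ([prob_not_spread]).  So let m
    vertices have distinct images on one side.  Whatever the earlier blocks are,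
    a new block of that side contains s of these vertices, one in each part and
    pairwise joined, with probability at least 1/2, provided that few pairs of
    the m vertices are close on either side ([prob_not_transversal]).  Hence all
    N blocks fail with probability at most 2^-N ([prob_no_transversal]), and N
    is chosen to beat the n^m choices of the vertices.

    A union bound over the m vertices would need very strong tail estimates to
    show that few pairs are close.  Instead this is a deterministic consequence
    of the absence of certain small configurations ([few_close_pairs]).  If too many pairs were close, a random sample of 2h of
    the m vertices, with h of order s^2 (log s)^2, would contain 40h close pairs
    such that the midpoint of each pair is adjacent to no other sampled vertex.
    These midpoints behave independently, and each is present by chance with
    probability a negative power of n, so no such configuration exists
    ([prob_has_configuration]).  This argument needs that no neighbourhood
    contains more than m / (4h) of the vertices, and this degree condition is
    what forces m^2 to be of order s^6 n log n ([degree_bound]). *)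

(** * Uniform probability on finite types and finite products *)

Section Uniform.
Variable Om : finType.
Implicit Types P Q : pred Om.

Definition prob (P : pred Om) : rat := #|P|%:R / #|Om|%:R.

Lemma prob_le1 P : prob P <= 1.
Proof.
rewrite /prob; case: (posnP #|Om|) => [->|Om0]; first by rewrite invr0 mulr0.
by rewrite ler_pdivrMr ?ltr0n // mul1r ler_nat max_card.
Qed.

Lemma prob_mono P Q : (forall w, P w -> Q w) -> prob P <= prob Q.
Proof.
move=> sPQ; rewrite ler_wpM2r ?invr_ge0 // ler_nat.
by apply: subset_leq_card; apply/fintype.subsetP=> w; apply: sPQ.
Qed.

Lemma probE P : prob P = (\sum_w (P w)%:R) / #|Om|%:R.
Proof.
rewrite /prob -sum1_card natr_sum big_mkcond; congr (_ / _).
by apply: eq_bigr => w _; rewrite unfold_in; case: (P w).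
Qed.

Lemma prob_exists (I : finType) (P : I -> pred Om) (p : I -> rat) :
  (forall i, prob (P i) <= p i) ->
  prob (fun w => [exists i, P i w]) <= \sum_i p i.
Proof.
move=> Pp; apply: (le_trans _ (ler_sum _ (fun i _ => Pp i))).
rewrite probE [leRHS](eq_bigr _ (fun i _ => probE (P i))).
rewrite -mulr_suml ler_wpM2r ?invr_ge0 // exchange_big ler_sum // => w _.
case: existsP => [[i Piw]|_]; last by rewrite sumr_ge0.
by rewrite (bigD1 i) //= Piw lerDl sumr_ge0.
Qed.

Lemma prob_exists_unif (I : finType) (P : I -> pred Om) (p : rat) :
  (forall i, prob (P i) <= p) ->
  prob (fun w => [exists i, P i w]) <= #|I|%:R * p.
Proof.
move=> Pp; apply: le_trans (prob_exists Pp) _.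
by rewrite sumr_const mulr_natl cardT.
Qed.

Lemma prob_or P Q : prob (fun w => P w || Q w) <= prob P + prob Q.
Proof.
rewrite !probE -mulrDl ler_wpM2r ?invr_ge0 // -big_split ler_sum // => w _ /=.
by case: (P w); case: (Q w).
Qed.

Lemma prob_lt1_ex P : prob P < 1 -> (0 < #|Om|)%N -> exists w, ~~ P w.
Proof.
move=> P1 Om0; apply/existsP; apply: contraTT P1; rewrite negb_exists => /forallP allP.
rewrite -leNgt probE ler_pdivlMr ?ltr0n // mul1r -sum1_card natr_sum.
by apply: ler_sum => w _; have := allP w; rewrite negbK => ->.
Qed.

End Uniform.

Section Product.
Variables X T : finType.
Let Om := {ffun X -> T}.
Implicit Types (w : Om) (S : {set X}).

Definition mix S (w' w : Om) : Om := [ffun x => if x \in S then w' x else w x].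

(** Exchanging the coordinates in [S] of two independent samples is an
    involution on pairs of samples. *)
Lemma sum_mix S (g : Om -> rat) :
  \sum_w \sum_w' g (mix S w' w) = #|Om|%:R * \sum_w g w.
Proof.
pose sw (p : Om * Om) := (mix S p.2 p.1, mix S p.1 p.2).
have swK : involutive sw.
  by case=> a b; rewrite /sw /=; congr pair; apply/ffunP=> x; rewrite !ffunE; case: (x \in S).
rewrite (pair_bigA _ (fun w w' => g (mix S w' w))) /=.
rewrite (reindex_inj (inv_inj swK)) /=.
have mixK (a b : Om) : mix S (mix S a b) (mix S b a) = a.
  by apply/ffunP=> x; rewrite !ffunE; case: (x \in S).
under eq_bigr => p _ do rewrite mixK.
rewrite -(pair_bigA _ (fun w _ => g w)) /= mulr_sumr.
by apply: eq_bigr => w _; rewrite sumr_const mulr_natl cardT.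
Qed.

(** Conditioning on the coordinates outside [S]: when the event [C] does not
    depend on the coordinates in [S], a bound for [E] that holds after fixing
    the other coordinates inside [C] multiplies the probability of [C].
    Every independence argument below is an instance, with [S] a row or a
    column of the table of labels. *)
Lemma prob_resample S (C E : pred Om) (p : rat) :
  (forall w, E w -> C w) ->
  (forall w w', C (mix S w' w) = C w) ->
  (forall w, C w -> prob (fun w' => E (mix S w' w)) <= p) ->
  prob E <= p * prob C.
Proof.
move=> sEC CS Ep.
have [Om0|OmN0] := posnP #|Om|; first by rewrite /prob Om0 invr0 !mulr0.
have Om_gt0 : 0 < #|Om|%:R :> rat by rewrite ltr0n.
rewrite !probE mulrA ler_wpM2r ?invr_ge0 //.
rewrite -(ler_pM2l Om_gt0) -(sum_mix S (fun w => (E w)%:R)) mulrCA mulr_sumr mulr_sumr.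
apply: ler_sum => w _; have [Cw|nCw] := boolP (C w).
  by rewrite mulr1 -ler_pdivrMr //; have := Ep w Cw; rewrite probE.
rewrite /= mulr0 mulr0 big1 // => w' _; case Em: (E _) => //.
by have := sEC _ Em; rewrite CS (negbTE nCw).
Qed.

Lemma prob_cylinder S (A : X -> pred T) : (0 < #|T|)%N ->
  prob (fun w : Om => [forall x in S, A x (w x)]) =
  \prod_(x in S) (#|A x|%:R / #|T|%:R).
Proof.
move=> T_gt0; pose F x : pred T := if x \in S then A x else predT.
transitivity (#|family F|%:R / #|Om|%:R : rat).
  congr (_%:R / _); apply: eq_card => w; rewrite unfold_in; apply/idP/idP.
    move/forallP=> Aw; apply/familyP=> x; rewrite /F; have := Aw x.
    by case: (x \in S).
  move=> Fw; apply/forallP=> x; apply/implyP => Sx.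
  by have /familyP/(_ x) := Fw; rewrite /F Sx.
rewrite card_family card_ffun foldrE big_image /= natrX -prodr_const.
rewrite -prodfV natr_prod -big_split /= [RHS]big_mkcond.
apply: eq_bigr => x _; rewrite /F; case: (x \in S) => //.
by rewrite divff // pnatr_eq0 -lt0n.
Qed.

Lemma prob_cylinder_le S (A : X -> pred T) (p : rat) : (0 < #|T|)%N ->
  (forall x, x \in S -> #|A x|%:R / #|T|%:R <= p) ->
  prob (fun w : Om => [forall x in S, A x (w x)]) <= p ^+ #|S|.
Proof.
move=> T0 Ap; rewrite prob_cylinder // -prodr_const; apply: ler_prod => x Sx.
by rewrite divr_ge0 //= Ap.
Qed.

(** Union bound over the [a]-subsets of [Y] on which all the events hold. *)
Lemma prob_many (Y : {set X}) (A : X -> pred T) (p : rat) (a : nat) :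
  (0 < #|T|)%N -> 0 <= p ->
  (forall x, x \in Y -> #|A x|%:R / #|T|%:R <= p) ->
  prob (fun w : Om => (a <= #|[set x in Y | A x (w x)]|)%N)
    <= 'C(#|Y|, a)%:R * p ^+ a.
Proof.
move=> T0 p0 Ap.
pose E (S : {set X}) (w : Om) :=
  [&& S \subset Y, #|S| == a & [forall x in S, A x (w x)]].
have E_le S : prob (E S) <= if (S \subset Y) && (#|S| == a) then p ^+ a else 0.
  rewrite /E; case sSY: (S \subset Y) => /=; last by rewrite probE big1 ?mul0r.
  case: eqP => [<-|_] /=; last by rewrite probE big1 ?mul0r.
  by apply: prob_cylinder_le => // x Sx; apply: Ap; apply: (fintype.subsetP sSY).
apply: le_trans (_ : prob (fun w => [exists S, E S w]) <= _).
  apply: prob_mono => w /card_geqP [u [Uu szu su]].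
  apply/existsP; exists [set x in u]; apply/and3P; split.
  - by apply/fintype.subsetP=> x; rewrite inE => /su; rewrite inE => /andP[].
  - by rewrite cardsE (card_uniqP Uu) szu.
  - by apply/forall_inP=> x; rewrite inE => /su; rewrite inE => /andP[].
apply: le_trans (prob_exists E_le) _.
rewrite -big_mkcond sumr_const mulr_natl -cards_draws.
by rewrite -[X in _ *+ X <= _]cardsE.
Qed.

End Product.

(** Both sides are compared with the falling factorial of [a + a], which is
    the central binomial coefficient times the factorial of [a]. *)
Lemma expn_le_fact a : (a ^ a <= 4 ^ a * a`!)%N.
Proof.
have le_ff : (a ^ a <= (a + a) ^_ a)%N.
  have: forall i, (i <= a -> a ^ i <= (a + i) ^_ i)%N.
    elim=> // i IHi /ltnW /IHi le_i.
    by rewrite addnS ffactSS expnS leq_mul // ltnW // ltnS leq_addr.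
  by apply.
apply: leq_trans le_ff _; rewrite -bin_ffact leq_mul2r; apply/orP; right.
rewrite (_ : 4 ^ a = (1 + 1) ^ (a + a))%N; last by rewrite (addnn a) -mul2n expnM.
rewrite Pascal (bigD1 (inord a)) //= inordK ?ltnS ?leq_addr //.
by rewrite !exp1n !muln1 leq_addr.
Qed.

Lemma bin_tail_le (n a : nat) (p : rat) :
  0 <= p -> 'C(n, a)%:R * p ^+ a * a%:R ^+ a <= (4 * n%:R * p) ^+ a.
Proof.
move=> p0; rewrite !exprMn -!mulrA [p ^+ a * _]mulrC !mulrA ler_wpM2r ?exprn_ge0 //.
rewrite -!natrX -!natrM ler_nat mulnC.
apply: leq_trans (leq_mul (expn_le_fact a) (leqnn _)) _.
rewrite -mulnA leq_mul2l; apply/orP; right; rewrite mulnC bin_ffact.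
by elim: a => // a IHa; rewrite ffactnSr expnSr leq_mul // leq_subr.
Qed.

(** The form in which tails are used: eight times the mean is exceeded with
    probability exponentially small in the threshold. *)
Lemma bin_tail_half (n a : nat) (p : rat) :
  0 <= p -> 8 * n%:R * p <= a%:R -> 'C(n, a)%:R * p ^+ a <= 2^-1 ^+ a.
Proof.
move=> p0 ha; case: a ha => [|a] ha; first by rewrite bin0 !expr0.
have a0 : 0 < a.+1%:R ^+ a.+1 :> rat by rewrite exprn_gt0 // ltr0n.
rewrite -(ler_pM2r a0); apply: le_trans (bin_tail_le _ _ p0) _.
rewrite -exprMn; apply: lerXn2r; rewrite ?nnegrE; last by lra.
  exact: mulr_ge0 (mulr_ge0 (ler0n _ 4) (ler0n _ _)) p0.
by apply: mulr_ge0; rewrite ?invr_ge0.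
Qed.

(** * Block systems and the graph of two block systems *)

Section BlockSystem.
Variables (N s L : nat) (B : finType).

(** A label below [s] is a part of the block; any larger label means that the
    point is absent from it. *)
Definition block_system := {ffun 'I_N * B -> 'I_L}.
Implicit Types (w : block_system) (l : 'I_N) (j : nat) (x y z : B).

Definition present w l x := (w (l, x) < s)%N.

(** Restricting to the blocks below [j] lets the same relation describe the
    history that the block [j] sees. *)
Definition share w j x y :=
  [exists l : 'I_N, [&& (l < j)%N, present w l x & present w l y]].

(** Points that both lie in a common block are included, with one of them as
    the midpoint, so this is distance at most two. *)
Definition close w j x y := [exists z, share w j x z && share w j z y].

Definition spoiled w l x :=
  [exists y, [&& y != x, present w l y & share w l x y]].

(** The two kinds of deletion depend on earlier blocks only, apart from the
    presence of points in the block itself, so that blocks can be exposed one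
    after the other. *)
Definition block_edge w l x y :=
  [&& present w l x, present w l y, w (l, x) != w (l, y), ~~ close w l x y,
      ~~ spoiled w l x & ~~ spoiled w l y].

Lemma share_sym w j : symmetric (share w j).
Proof. by move=> x y; apply: eq_existsb => l; rewrite [present w l x && _]andbC. Qed.

Lemma close_sym w j : symmetric (close w j).
Proof.
by move=> x y; apply: eq_existsb => z; rewrite andbC ![share w j _ z]share_sym.
Qed.

Lemma block_edge_sym w l : symmetric (block_edge w l).
Proof.
move=> x y; rewrite /block_edge close_sym eq_sym !andbA.
by rewrite [present w l x && _]andbC -!andbA [~~ spoiled w l x && _]andbC.
Qed.

Lemma share_mono w j j' x y : (j <= j')%N -> share w j x y -> share w j' x y.
Proof.
move=> le_jj' /existsP[l /and3P[lt_lj xl yl]]; apply/existsP; exists l.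
by rewrite xl yl (leq_trans lt_lj).
Qed.

Lemma close_mono w j j' x y : (j <= j')%N -> close w j x y -> close w j' x y.
Proof.
move=> le_jj' /existsP[z /andP[xz zy]]; apply/existsP; exists z.
by rewrite !(share_mono le_jj').
Qed.

Lemma block_edge_share w l j x y : (l < j)%N -> block_edge w l x y -> share w j x y.
Proof.
by move=> lj /and3P[xl yl _]; apply/existsP; exists l; rewrite lj xl.
Qed.

Lemma block_edge_neq w l x y : block_edge w l x y -> x != y.
Proof. by case/and4P=> _ _ Nlab _; apply: contraNneq Nlab => ->. Qed.

(** Look at the last block used by a triangle.  If it carries one edge only,
    the ends of that edge are close through earlier blocks; if it carries
    exactly two, the third edge makes its ends spoiled there. *)
Lemma triangle_last_block w l1 l2 l3 x y z :
    block_edge w l1 x y -> block_edge w l2 y z -> block_edge w l3 x z ->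
  (l2 <= l1)%N -> (l3 <= l1)%N -> l2 = l1 /\ l3 = l1.
Proof.
move=> xy yz xz le21 le31.
have [Nclose Nspx Nspy] : [/\ ~~ close w l1 x y, ~~ spoiled w l1 x & ~~ spoiled w l1 y].
  by case/and5P: xy => _ _ _ -> /andP[].
have [lt21|ge21] := ltnP l2 l1; have [lt31|ge31] := ltnP l3 l1.
- case/negP: Nclose; apply/existsP; exists z.
  by rewrite (block_edge_share lt31 xz) share_sym (block_edge_share lt21 yz).
- have l31 : l3 = l1 by apply/val_inj/anti_leq; rewrite le31.
  case/negP: Nspy; apply/existsP; exists z.
  rewrite eq_sym (block_edge_neq yz) (block_edge_share lt21 yz) andbT /=.
  by rewrite -l31; case/and3P: xz.
- have l21 : l2 = l1 by apply/val_inj/anti_leq; rewrite le21.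
  case/negP: Nspx; apply/existsP; exists z.
  rewrite eq_sym (block_edge_neq xz) (block_edge_share lt31 xz) andbT /=.
  by rewrite -l21; case/and3P: yz.
- by split; apply/val_inj/anti_leq; rewrite ?le21 ?le31.
Qed.

Lemma triangle_one_block w l1 l2 l3 x y z :
    block_edge w l1 x y -> block_edge w l2 y z -> block_edge w l3 x z ->
  l1 = l2 /\ l1 = l3.
Proof.
move=> xy yz xz.
have yx : block_edge w l1 y x by rewrite block_edge_sym.
have zy : block_edge w l2 z y by rewrite block_edge_sym.
have zx : block_edge w l3 z x by rewrite block_edge_sym.
have [le12|/ltnW le21] := leqP l1 l2.
  have [le32|/ltnW le23] := leqP l3 l2.
    by case: (triangle_last_block yz zx yx) => // -> ->.
  by case: (triangle_last_block xz zy xy) => //; [apply: leq_trans le23|move=> -> ->].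
have [le31|/ltnW le13] := leqP l3 l1.
  by case: (triangle_last_block xy yz xz) => // -> ->.
by case: (triangle_last_block xz zy xy) => //; [apply: leq_trans le13|move=> -> ->].
Qed.

End BlockSystem.

Section Graph.
Variables (N s L : nat) (B V : finType).
Variables (pos : bool -> V -> B) (sys : bool -> block_system N L B).

Let bad c u v :=
  (pos c u == pos c v) || close s (sys c) N (pos c u) (pos c v).

Definition col_edge (c : bool * 'I_N) u v :=
  block_edge s (sys c.1) c.2 (pos c.1 u) (pos c.1 v) && ~~ bad (~~ c.1) u v.

(** A colour is a side together with a block of that side; the graph keeps the
    pairs that have a valid colour. *)
Definition two_system_edge : rel V := fun u v => [exists c, col_edge c u v].

Lemma col_edge_sym c : symmetric (col_edge c).
Proof.
by move=> u v; rewrite /col_edge block_edge_sym /bad close_sym eq_sym.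
Qed.

Lemma two_system_edge_sym : symmetric two_system_edge.
Proof. by move=> u v; apply: eq_existsb => c; apply: col_edge_sym. Qed.

Lemma col_edge_neq c u v : col_edge c u v -> u != v.
Proof. by case/andP=> /block_edge_neq npos _; apply: contra_neq npos => ->. Qed.

Lemma two_system_edge_irrefl : irreflexive two_system_edge.
Proof.
by move=> u; apply/negbTE/existsP => -[c /col_edge_neq]; rewrite eqxx.
Qed.

Definition two_system_graph : sgraph :=
  SGraph two_system_edge_sym two_system_edge_irrefl.

Lemma col_path_bad c1 c2 u v x :
  c1.1 = c2.1 -> col_edge c1 u x -> col_edge c2 x v -> bad c1.1 u v.
Proof.
move=> e12 /andP[ux _] /andP[xv _]; apply/orP; right.
apply/existsP; exists (pos c1.1 x).
rewrite (block_edge_share (ltn_ord _) ux) e12.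
by rewrite (block_edge_share (ltn_ord _) xv).
Qed.

(** If two edges of a triangle come from the same side, the ends of the third
    are close on that side, which forbids the third edge to come from the
    other one. *)
Lemma col_triangle c1 c2 c3 u v x :
    col_edge c1 u v -> col_edge c2 v x -> col_edge c3 u x -> c1 = c2 /\ c1 = c3.
Proof.
move=> uv vx ux.
have vu : col_edge c1 v u by rewrite col_edge_sym.
have xv : col_edge c2 x v by rewrite col_edge_sym.
have xu : col_edge c3 x u by rewrite col_edge_sym.
have same (d1 d2 d3 : bool * 'I_N) a b d : d1.1 = d2.1 -> col_edge d1 a d ->
    col_edge d2 d b -> col_edge d3 a b -> d3.1 = d1.1.
  move=> e12 ad db /andP[_]; have := col_path_bad e12 ad db.
  by case: (d1.1); case: (d3.1) => //= ->.
have [e1 e2] : c1.1 = c2.1 /\ c1.1 = c3.1.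
  (* Two of the three sides coincide. *)
  have [e12|n12] := eqVneq c1.1 c2.1.
    by split=> //; rewrite (same c1 c2 c3 u x v).
  have [e13|n13] := eqVneq c1.1 c3.1.
    by split=> //; rewrite (same c1 c3 c2 v x u).
  have e23 : c2.1 = c3.1 by case: (c1.1) (c2.1) (c3.1) n12 n13 => [] [] [].
  by rewrite (same c2 c3 c1 v u x) // eqxx in n12.
case: c1 c2 c3 e1 e2 {vu xv xu} uv vx ux => c l1 [c2 l2] [c3 l3] /= <- <-.
move=> /andP[/= uv _] /andP[/= vx _] /andP[/= ux _].
by case: (triangle_one_block uv vx ux) => -> ->.
Qed.

(** All triangles of a clique having one colour, all its edges have the same
    colour, so its vertices carry distinct labels below [s] in one block. *)
Lemma two_system_graph_free : (1 < s)%N ->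
  free_of (complete_graph s.+1) two_system_graph.
Proof.
move=> s1 [/= f f_inj f_edge].
have edgeE i j : i != j -> exists c, col_edge c (f i) (f j).
  by move=> /f_edge /existsP.
have n01 : ord0 != ord_max :> 'I_s.+1 by rewrite -val_eqE /= neq_ltn (ltnW s1).
have [c0 e01] := edgeE _ _ n01.
have e0 j : j != ord0 -> col_edge c0 (f ord0) (f j).
  have [-> //|nj1 nj0] := eqVneq j ord_max.
  have [|c e0j] := edgeE ord0 j; first by rewrite eq_sym.
  have [|c' e1j] := edgeE ord_max j; first by rewrite eq_sym.
  by have [_ ->] := col_triangle e01 e1j e0j.
have e i j : i != j -> col_edge c0 (f i) (f j).
  have [-> n0j|ni0 nij] := eqVneq i ord0; first by rewrite e0 // eq_sym.
  have [->|nj0] := eqVneq j ord0; first by rewrite col_edge_sym e0.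
  have [c eij] := edgeE i j nij.
  by have [-> _] := col_triangle (e0 _ ni0) eij (e0 _ nj0).
pose lab i := sys c0.1 (c0.2, pos c0.1 (f i)).
have lab_lt i : (lab i < s)%N.
  have [j nij] : exists j : 'I_s.+1, i != j.
    by have [->|ni0] := eqVneq i ord0; [exists ord_max | exists ord0].
  by case/andP: (e i j nij) => /and3P[].
have /leq_card : injective (fun i => Ordinal (lab_lt i)).
  move=> i j [/val_inj eq_lab]; apply/eqP; apply: contraT => /e /andP[/and4P[_ _]].
  by rewrite -/(lab i) -/(lab j) eq_lab eqxx.
by rewrite !card_ord ltnn.
Qed.

End Graph.

(** * Each new block is likely to contain a transversal clique *)

Lemma prob_exists_in (Om I : finType) (A : pred I) (P : I -> pred Om) (p : rat) :
  0 <= p -> (forall i, A i -> prob (P i) <= p) ->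
  prob (fun w => [exists i, A i && P i w]) <= #|A|%:R * p.
Proof.
move=> p0 Pp.
apply: le_trans (prob_exists (p := fun i => if A i then p else 0) _) _.
  move=> i; case: ifP => [Ai|_]; first exact: Pp.
  by rewrite probE big1 ?mul0r.
by rewrite -big_mkcond sumr_const mulr_natl.
Qed.

Lemma card_pairs (A B : finType) (P : A -> pred B) :
  #|[pred p : A * B | P p.1 p.2]| = (\sum_a #|P a|)%N.
Proof.
rewrite -sum1_card -(pair_big_dep xpredT P (fun _ _ => 1%N)) /=.
by apply: eq_bigr => a _; rewrite sum1_card.
Qed.

Lemma card_small_label (s L : nat) : (#|[pred t : 'I_L | (t < s)%N]| <= s)%N.
Proof.
have sub : [pred t : 'I_L | (t < s)%N] \subset (pmap insub (iota 0 s) : seq 'I_L).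
  by apply/fintype.subsetP => t; rewrite mem_pmap_sub mem_iota.
apply: leq_trans (subset_leq_card sub) (leq_trans (card_size _) _).
by rewrite size_pmap_sub (leq_trans (count_size _ _)) ?size_iota.
Qed.

Section Transversals.
Variables (N s L : nat) (B : finType) (m : nat).
Hypothesis (L_gt0 : (0 < L)%N).
Let Om := block_system N L B.
Implicit Types (w : Om) (l : 'I_N).

Lemma prob_both_present l1 x l2 z :
  (l1, x) != (l2, z) ->
  prob (fun w : Om => present s w l1 x && present s w l2 z) <= (s%:R / L%:R) ^+ 2.
Proof.
move=> nxz; rewrite (_ : 2%N = #|[set (l1, x); (l2, z)]|); last by rewrite cards2 nxz.
apply: le_trans (prob_cylinder_le (A := fun _ => [pred t : 'I_L | (t < s)%N]) _ _).
- apply: prob_mono => w /andP[xl zl]; apply/forall_inP => p.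
  by rewrite !inE => /orP[] /eqP ->.
- by rewrite card_ord.
- move=> p _; rewrite card_ord ler_wpM2r ?invr_ge0 // ler_nat.
  exact: card_small_label.
Qed.

Variable y : 'I_m -> B.
Hypothesis y_inj : injective y.
Variable other : rel 'I_m.

(** The three clauses give what [block_edge] and the other side require of [s]
    vertices with all the labels below [s]: all the labels occur, the pairs are
    neither close nor excluded by [other], and no vertex is spoiled. *)
Definition transversal_block w l :=
  [&& [forall c : 'I_s, exists a, w (l, y a) == c :> nat],
      [forall a, forall b, [&& a != b, present s w l (y a) & present s w l (y b)]
          ==> ~~ (other a b || close s w l (y a) (y b))] &
      [forall a, present s w l (y a) ==> ~~ spoiled s w l (y a)]].

Definition regular_prefix (phi D : nat) w (j : nat) :=
  (#|[pred p : 'I_m * 'I_m | close s w j (y p.1) (y p.2)]| <= phi)%N &&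
  [forall x, (#|share s w j x| <= D)%N].

Let row l := [set p : 'I_N * B | p.1 == l].

Lemma share_mix l w' w : share s (mix (row l) w' w) l =2 share s w l.
Proof.
move=> x z; apply: eq_existsb => i; rewrite /present !ffunE !inE /=.
by case: ltngtP => //; case: eqP => // ->; rewrite ltnn.
Qed.

Lemma close_mix l w' w : close s (mix (row l) w' w) l =2 close s w l.
Proof. by move=> x z; apply: eq_existsb => i; rewrite !share_mix. Qed.

(** First moment over the three ways to fail: a label that occurs nowhere, an
    excluded pair that is present, and a vertex that is present together with
    one of its earlier neighbours. *)
Lemma prob_not_transversal (phi phi' D : nat) l w :
  (s <= L)%N -> (#|[pred p : 'I_m * 'I_m | other p.1 p.2]| <= phi')%N ->
  regular_prefix phi D w l ->
  prob (fun w' => ~~ transversal_block (mix (row l) w' w) l) <=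
    s%:R * ((L%:R - 1) / L%:R) ^+ m
      + (phi' + phi + m * D)%:R * (s%:R / L%:R) ^+ 2.
Proof.
move=> le_sL le_oth /andP[le_close /forallP le_share].
pose miss (c : 'I_s) (w' : Om) := [forall a, w' (l, y a) != c :> nat].
pose both x z (w' : Om) := present s w' l x && present s w' l z.
pose A1 := [pred p : 'I_m * 'I_m | (p.1 != p.2) && (other p.1 p.2 || close s w l (y p.1) (y p.2))].
pose A2 := [pred p : 'I_m * B | share s w l (y p.1) p.2 && (p.2 != y p.1)].
apply: le_trans (_ : prob (fun w' => [exists c, miss c w'] ||
   ([exists p, A1 p && both (y p.1) (y p.2) w'] ||
    [exists p, A2 p && both (y p.1) p.2 w'])) <= _).
  apply: prob_mono => w'; rewrite /transversal_block !negb_and => /or3P[] /forallPn[].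
  - move=> c /existsPn nc; apply/orP; left; apply/existsP; exists c.
    by apply/forallP => a; have := nc a; rewrite ffunE inE eqxx.
  - move=> a /forallPn[b]; rewrite negb_imply close_mix negbK => /andP[/and3P[nab pa pb] oc].
    apply/orP; right; apply/orP; left; apply/existsP; exists (a, b).
    rewrite /A1 /= nab oc /=; move: pa pb; rewrite /both /present !ffunE !inE eqxx.
    by move=> -> ->.
  - move=> a; rewrite negb_imply negbK => /andP[pa /existsP[z /and3P[nz pz]]].
    rewrite share_mix => az; apply/orP; right; apply/orP; right.
    apply/existsP; exists (a, z); rewrite /A2 /= az nz /=.
    by move: pa pz; rewrite /both /present !ffunE !inE eqxx => -> ->.
have L0 : 0 < L%:R :> rat by rewrite ltr0n.
have L1 : 0 <= (L%:R - 1) / L%:R :> rat.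
  by rewrite divr_ge0 // subr_ge0 ler1n.
have sL0 : 0 <= (s%:R / L%:R) ^+ 2 :> rat by rewrite exprn_ge0 ?divr_ge0.
apply: le_trans (prob_or _ _) _; apply: lerD.
  apply: le_trans (prob_exists_unif (p := ((L%:R - 1) / L%:R) ^+ m) _) _; last first.
    by rewrite card_ord.
  move=> c; pose S := [set (l, y a) | a : 'I_m].
  have -> : m = #|S| by rewrite card_imset ?card_ord // => a b [/y_inj].
  apply: le_trans (prob_cylinder_le (A := fun _ => [pred t : 'I_L | t != c :> nat]) _ _).
  - apply: prob_mono => w' /forallP mc; apply/forall_inP => p /imsetP[a _ ->].
    by have := mc a.
  - by rewrite card_ord.
  - move=> p _; rewrite card_ord ler_wpM2r ?invr_ge0 // -(@natrB rat L 1) // ler_nat.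
    have := cardC1 (Ordinal (leq_trans (ltn_ord c) le_sL)); rewrite card_ord subn1 => <-.
    by apply: subset_leq_card; apply/fintype.subsetP => t; rewrite !inE.
apply: le_trans (prob_or _ _) _; rewrite natrD mulrDl; apply: lerD.
  apply: le_trans (prob_exists_in (p := (s%:R / L%:R) ^+ 2) sL0 _) _.
    move=> p /andP[np _]; apply: prob_both_present.
    by apply: contra_neq np => -[/y_inj].
  rewrite ler_wpM2r // ler_nat.
  apply: leq_trans (leq_add le_oth le_close); rewrite -cardUI.
  apply: leq_trans (leq_addr _ _); apply: subset_leq_card; apply/fintype.subsetP => p.
  by rewrite !inE => /andP[_].
apply: le_trans (prob_exists_in (p := (s%:R / L%:R) ^+ 2) sL0 _) _.
  move=> p /andP[_ np]; apply: prob_both_present.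
  by apply: contra_neq np => -[].
rewrite ler_wpM2r // ler_nat.
apply: leq_trans (_ : #|[pred p : 'I_m * B | share s w l (y p.1) p.2]| <= _)%N.
  by apply: subset_leq_card; apply/fintype.subsetP => p; rewrite !inE => /andP[].
rewrite (card_pairs (fun a => share s w l (y a))).
rewrite -[X in (_ <= X * _)%N]card_ord -sum_nat_const; apply: leq_sum => a _.
exact: le_share.
Qed.

(** The blocks are exposed in order.  Regularity of the history is part of the
    event, so that the conditional bound applies at each step. *)
Lemma prob_no_transversal (phi phi' D : nat) :
  (s <= L)%N -> (#|[pred p : 'I_m * 'I_m | other p.1 p.2]| <= phi')%N ->
  s%:R * ((L%:R - 1) / L%:R) ^+ m
      + (phi' + phi + m * D)%:R * (s%:R / L%:R) ^+ 2 <= 2^-1 :> rat ->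
  prob (fun w => [forall l : 'I_N, regular_prefix phi D w l && ~~ transversal_block w l])
    <= 2^-1 ^+ N.
Proof.
move=> le_sL le_oth half.
pose E j w := [forall l : 'I_N, (l < j)%N ==>
  (regular_prefix phi D w l && ~~ transversal_block w l)].
have mixE (l i : 'I_N) w w' x : i != l -> mix (row l) w' w (i, x) = w (i, x).
  by move=> nil; rewrite ffunE inE /= (negbTE nil).
have share_mix' l i w w' : (i <= l)%N -> share s (mix (row l) w' w) i =2 share s w i.
  move=> le_il x z; apply: eq_existsb => i'; case: (ltnP i' i) => //= lt_i'i.
  by rewrite /present !mixE // -val_eqE neq_ltn (leq_trans lt_i'i).
have close_mix' l i w w' : (i <= l)%N -> close s (mix (row l) w' w) i =2 close s w i.
  by move=> le_il x z; apply: eq_existsb => i'; rewrite !share_mix'.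
have reg_mix l i w w' : (i <= l)%N ->
    regular_prefix phi D (mix (row l) w' w) i = regular_prefix phi D w i.
  move=> le_il; congr (_ && _).
    by congr (_ <= _)%N; apply: eq_card => p; rewrite !inE close_mix'.
  apply: eq_forallb => x; congr (_ <= _)%N; apply: eq_card => z.
  exact: (share_mix' l i w w' le_il x z).
have tr_mix l (i : 'I_N) w w' : (i < l)%N ->
    transversal_block (mix (row l) w' w) i = transversal_block w i.
  move=> lt_il; have nil : i != l by rewrite -val_eqE neq_ltn lt_il.
  have le_il := ltnW lt_il.
  congr [&& _, _ & _].
  - by apply: eq_forallb => c; apply: eq_existsb => a; rewrite mixE.
  - apply: eq_forallb => a; apply: eq_forallb => b.
    by rewrite /present !mixE // close_mix'.
  - apply: eq_forallb => a; rewrite /present mixE //; congr (_ ==> ~~ _).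
    by apply: eq_existsb => z; rewrite /present mixE // share_mix'.
have Ej j : (j <= N)%N -> prob (E j) <= 2^-1 ^+ j.
  elim: j => [|j IHj] lt_jN; first by rewrite expr0 prob_le1.
  pose l := Ordinal lt_jN.
  rewrite exprS; apply: le_trans (_ : 2^-1 * prob (E j) <= _); last first.
    by rewrite ler_wpM2l ?IHj // ltnW.
  have E_mix w w' : E j (mix (row l) w' w) = E j w.
    apply: eq_forallb => i; case: ltnP => //= lt_ij.
    by rewrite reg_mix ?tr_mix // ltnW.
  have sE w : E j.+1 w -> E j w.
    move=> /forallP Ew; apply/forallP => i; apply/implyP => lt_ij.
    by have := Ew i; rewrite ltnW.
  apply: (prob_resample (S := row l) sE E_mix) => w Ew.
  have [regw|nreg] := boolP (regular_prefix phi D w l).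
    apply: le_trans half; apply: le_trans (prob_not_transversal le_sL le_oth regw).
    by apply: prob_mono => w' /forallP/(_ l); rewrite ltnSn => /andP[].
  rewrite probE big1 ?mul0r // => w' _; case Ew': (E _ _) => //.
  by case/forallP/(_ l): Ew'; rewrite ltnSn reg_mix // (negbTE nreg).
apply: le_trans (Ej N (leqnn _)); apply: prob_mono => w /forallP Hw.
by apply/forallP => l; rewrite Hw implybT.
Qed.

End Transversals.

(** * Few pairs of chosen vertices are close *)

Section Regularity.
Variables (N s L : nat) (B : finType).
Hypothesis (L_gt0 : (0 < L)%N).
Let Om := block_system N L B.
Implicit Types (w : Om) (l : 'I_N).

Definition regular_system (ad ab : nat) w :=
  [forall x, (#|[pred l | present s w l x]| < ad)%N] &&
  [forall l, (#|[pred x | present s w l x]| < ab)%N].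

Lemma prob_many_present (I : finType) (c : I -> 'I_N * B) (a : nat) :
  injective c -> (8 * #|I| * s <= a * L)%N ->
  prob (fun w : Om => (a <= #|[pred i | (w (c i) < s)%N]|)%N) <= 2^-1 ^+ a.
Proof.
move=> c_inj le_a; pose Y := [set c i | i : I].
have L0 : 0 < L%:R :> rat by rewrite ltr0n.
have sL0 : 0 <= s%:R / L%:R :> rat by rewrite divr_ge0.
apply: le_trans (_ : 'C(#|Y|, a)%:R * (s%:R / L%:R) ^+ a <= _).
  apply: le_trans (prob_many (Y := Y) (A := fun _ => [pred t : 'I_L | (t < s)%N]) a _ sL0 _).
  - apply: prob_mono => w; rewrite -(card_imset _ c_inj) => /leq_trans; apply.
    apply: subset_leq_card; apply/fintype.subsetP => p /imsetP[i]; rewrite !inE => wi ->.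
    by rewrite wi imset_f.
  - by rewrite card_ord.
  - move=> p _; rewrite card_ord ler_wpM2r ?invr_ge0 // ler_nat.
    exact: card_small_label.
apply: bin_tail_half => //; rewrite card_imset // mulrA ler_pdivrMr // -!natrM ler_nat.
exact: le_a.
Qed.

(** All these counts are binomial, and the thresholds are at least eight times
    their means. *)
Lemma prob_irregular (ad ab : nat) :
  (8 * N * s <= ad * L)%N -> (8 * #|B| * s <= ab * L)%N ->
  prob (fun w : Om => ~~ regular_system ad ab w) <=
    #|B|%:R * 2^-1 ^+ ad + N%:R * 2^-1 ^+ ab.
Proof.
move=> le_ad le_ab.
apply: le_trans (_ : prob (fun w : Om =>
    [exists x, (ad <= #|[pred l | present s w l x]|)%N] ||
    [exists l, (ab <= #|[pred x | present s w l x]|)%N]) <= _).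
  apply: prob_mono => w; rewrite negb_and => /orP[]/forallPn[i]; rewrite -leqNgt => le_i.
    by apply/orP; left; apply/existsP; exists i.
  by apply/orP; right; apply/existsP; exists i.
apply: le_trans (prob_or _ _) _; apply: lerD.
  apply: prob_exists_unif => x.
  by apply: (@prob_many_present _ (fun l : 'I_N => (l, x))) => [l l' []|]; rewrite ?card_ord.
rewrite -[in N%:R](card_ord N); apply: prob_exists_unif => l.
by apply: (@prob_many_present _ (fun x : B => (l, x))) => [x x' []|].
Qed.

Lemma card_share (ad ab : nat) w x :
  regular_system ad ab w -> (#|share s w N x| <= ad * ab)%N.
Proof.
case/andP=> /forallP reg_x /forallP reg_l.
apply: leq_trans (_ : \sum_(l | present s w l x) #|[pred z | present s w l z]| <= _)%N.
  under eq_bigr do rewrite -sum1_card big_mkcond.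
  rewrite exchange_big /= -sum1_card big_mkcond leq_sum // => z _.
  rewrite unfold_in; case: existsP => [[l /and3P[_ xl zl]]|//].
  by rewrite (bigD1 l) //= unfold_in /= zl.
apply: leq_trans (_ : \sum_(l | present s w l x) ab <= _)%N.
  by apply: leq_sum => l _; apply: ltnW.
rewrite sum_nat_const leq_mul2r; apply/orP; right; exact: ltnW (reg_x x).
Qed.

End Regularity.

Section Configurations.
Variables (N s L : nat) (B : finType) (ad h v : nat).
Hypothesis (L_gt0 : (0 < L)%N).
Let Om := block_system N L B.
Implicit Types (w : Om) (l : 'I_N).

(** The two blocks have to differ: a midpoint that shares one single block with
    both ends is not rare. *)
Definition linked w (x z y : B) :=
  [exists p : 'I_N * 'I_N, [&& p.1 != p.2, present s w p.1 x & present s w p.2 y]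
     && (present s w p.1 z && present s w p.2 z)].

(** [g] consists of [h + h] sampled points, [v] pairs of sample indices, and a
    private midpoint for each of these pairs.  The bound on the number of
    blocks through a sampled point is part of the event because these blocks
    are common to many pairs and cannot be paid for by each of them. *)
Definition configuration
    (g : {ffun 'I_h + 'I_h -> B} * {ffun 'I_v -> 'I_h * 'I_h} * {ffun 'I_v -> B}) w :=
  let: (q, e, z) := g in
  [&& injectiveb z, [forall c, forall k, z c != q k],
      [forall k, (#|[pred l | present s w l (q k)]| <= ad)%N] &
      [forall c, linked w (q (inl (e c).1)) (z c) (q (inr (e c).2))]].

Definition has_configuration w := [exists g, configuration g w].

Let col z := [set p : 'I_N * B | p.2 == z].

Lemma prob_linked w x y z :
    x != z -> y != z ->
    (#|[pred l | present s w l x]| <= ad)%N -> (#|[pred l | present s w l y]| <= ad)%N ->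
  prob (fun w' => linked (mix (col z) w' w) x z y) <= (ad ^ 2)%:R * (s%:R / L%:R) ^+ 2.
Proof.
move=> nxz nyz le_x le_y.
pose A := [pred p : 'I_N * 'I_N | [&& p.1 != p.2, present s w p.1 x & present s w p.2 y]].
have sL0 : 0 <= (s%:R / L%:R) ^+ 2 :> rat by rewrite exprn_ge0 ?divr_ge0.
apply: le_trans (_ : #|A|%:R * (s%:R / L%:R) ^+ 2 <= _).
  apply: le_trans (prob_exists_in sL0 (A := A)
    (P := fun p w' => present s w' p.1 z && present s w' p.2 z) _).
    apply: prob_mono => w' /existsP[p Hp]; apply/existsP; exists p; move: Hp.
    by rewrite /present !ffunE !inE /= (negbTE nxz) (negbTE nyz) eqxx.
  move=> p /andP[np _]; apply: prob_both_present => //.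
  by apply: contra_neq np => -[].
rewrite ler_wpM2r // ler_nat.
apply: leq_trans
  (_ : #|[predX [pred l | present s w l x] & [pred l | present s w l y]]| <= _)%N.
  by apply: subset_leq_card; apply/fintype.subsetP => p; rewrite !inE => /andP[].
by rewrite cardX expnS expn1 leq_mul.
Qed.

(** The midpoints are distinct and are not sampled points, so that their
    columns of labels are independent of each other and of the blocks through
    the sampled points. *)
Lemma prob_configuration g :
  prob (configuration g) <= ((ad ^ 2)%:R * (s%:R / L%:R) ^+ 2) ^+ v.
Proof.
case: g => [[q e] z]; set theta := _ * _.
have th0 : 0 <= theta by rewrite mulr_ge0 ?exprn_ge0 ?divr_ge0.
have [/injectiveP z_inj|ninj] := boolP (injectiveb z); last first.
  by rewrite probE big1 ?mul0r ?exprn_ge0 // => w _; rewrite /= (negbTE ninj).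
have [/forallP zq|nzq] := boolP [forall c, forall k, z c != q k]; last first.
  by rewrite probE big1 ?mul0r ?exprn_ge0 // => w _; rewrite /= (negbTE nzq) andbF.
pose E j w := [forall k, (#|[pred l | present s w l (q k)]| <= ad)%N] &&
  [forall c : 'I_v, (c < j)%N ==> linked w (q (inl (e c).1)) (z c) (q (inr (e c).2))].
have Ej j : (j <= v)%N -> prob (E j) <= theta ^+ j.
  elim: j => [|j IHj] lt_jv; first by rewrite expr0 prob_le1.
  pose c := Ordinal lt_jv.
  have presE l x w w' : x != z c -> present s (mix (col (z c)) w' w) l x = present s w l x.
    by move=> nx; rewrite /present ffunE inE /= (negbTE nx).
  have qz k : q k != z c by have /forallP/(_ k) := zq c; rewrite eq_sym.
  rewrite exprS; apply: le_trans (_ : theta * prob (E j) <= _); last first.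
    by rewrite ler_wpM2l ?IHj // ltnW.
  apply: (prob_resample (S := col (z c))).
  - move=> w /andP[Hw /forallP Ew]; rewrite /E Hw; apply/forallP => c'.
    by apply/implyP => lt_c'j; have := Ew c'; rewrite ltnW.
  - move=> w w'; congr (_ && _).
      apply: eq_forallb => k; congr (_ <= _)%N; apply: eq_card => l.
      by rewrite !inE presE.
    apply: eq_forallb => c'; case: ltnP => //= lt_c'j.
    have nc : z c' != z c.
      by apply: contraTneq lt_c'j => /z_inj ->; rewrite /= ltnn.
    by apply: eq_existsb => p; rewrite !presE.
  - move=> w /andP[/forallP Hw _]; apply: le_trans (prob_linked (qz (inl (e c).1)) (qz (inr (e c).2)) (Hw _) (Hw _)).
    by apply: prob_mono => w' /andP[_ /forallP/(_ c)]; rewrite ltnSn.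
apply: le_trans (Ej v (leqnn _)); apply: prob_mono => w /and4P[_ _ Hw /forallP Ew].
by rewrite /E Hw; apply/forallP => c; rewrite Ew implybT.
Qed.

Lemma prob_has_configuration :
  prob (fun w => has_configuration w) <=
    (#|B| ^ (h + h) * (h * h) ^ v * #|B| ^ v)%:R * ((ad ^ 2)%:R * (s%:R / L%:R) ^+ 2) ^+ v.
Proof.
apply: le_trans (prob_exists_unif prob_configuration) _.
by rewrite !card_prod !card_ffun card_sum card_prod !card_ord.
Qed.

End Configurations.

Section CleanPairs.
Variables (N s L : nat) (B : finType) (ad ab h v m D : nat).
Let Om := block_system N L B.
Variable w : Om.
Hypothesis reg_w : regular_system s ad ab w.
Hypothesis noconf : ~~ has_configuration s ad h v w.
Variable y : 'I_m -> B.
Hypothesis m_gt0 : (0 < m)%N.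
Hypothesis share_y : forall x, (#|[pred a | share s w N x (y a)]| <= D)%N.
Hypothesis hD : (4 * h * D <= m)%N.

Let far (a b : 'I_m) := close s w N (y a) (y b) && ~~ share s w N (y a) (y b).
Let mid (a b : 'I_m) : B :=
  odflt (y a) [pick z | share s w N (y a) z && share s w N z (y b)].

Let midP a b : far a b -> share s w N (y a) (mid a b) && share s w N (mid a b) (y b).
Proof.
case/andP=> /existsP[z Hz] _; rewrite /mid; case: pickP => //= /(_ z).
by rewrite Hz.
Qed.

Let clean (i j : 'I_h) (q : {ffun 'I_h + 'I_h -> 'I_m}) :=
  far (q (inl i)) (q (inr j)) &&
  [forall k, (k != inl i) && (k != inr j) ==>
     ~~ share s w N (mid (q (inl i)) (q (inr j))) (y (q k))].

Let few_clean q : (#|[pred p | clean p.1 p.2 q]| < v)%N.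
Proof.
rewrite ltnNge; apply: contra noconf => le_v.
pose e := [ffun c : 'I_v => enum_val (widen_ord le_v c)].
have e_inj : injective e.
  by move=> c c'; rewrite !ffunE => /enum_val_inj /(congr1 val) /= /val_inj.
have eP c : clean (e c).1 (e c).2 q by rewrite ffunE; apply: (enum_valP (widen_ord le_v c)).
pose z := [ffun c => mid (q (inl (e c).1)) (q (inr (e c).2))].
have zP c := midP (proj1 (andP (eP c))).
have zE c : z c = mid (q (inl (e c).1)) (q (inr (e c).2)) by rewrite ffunE.
have yE k : [ffun k => y (q k)] k = y (q k) by rewrite ffunE.
have share_refl x z' : share s w N x z' -> share s w N z' z'.
  by case/existsP=> l /and3P[lN _ zl]; apply/existsP; exists l; rewrite lN zl.
apply/existsP; exists ([ffun k => y (q k)], e, z); apply/and4P; split.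
(* Of two distinct pairs, one has an index outside the other, and the point
   with this index would share a block with the common midpoint. *)
- apply/injectiveP => c c' eq_z; apply: e_inj; apply/eqP; apply: contraT => ne.
  have /andP[farc /forallP cleanc] := eP c.
  have /andP[z1 z2] := zP c'.
  have zz : mid (q (inl (e c').1)) (q (inr (e c').2)) =
            mid (q (inl (e c).1)) (q (inr (e c).2)) by rewrite -!zE.
  move: ne; rewrite -pair_eqE /= negb_and => /orP[] ne.
    have nk : inl (e c').1 != inl (e c).1 :> 'I_h + 'I_h by apply: contra_neq ne => -[].
    by have := cleanc (inl (e c').1); rewrite nk -zz share_sym z1.
  have nk : inr (e c').2 != inr (e c).2 :> 'I_h + 'I_h by apply: contra_neq ne => -[].
  by have := cleanc (inr (e c').2); rewrite nk -zz z2.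
- apply/forallP => c; apply/forallP => k; rewrite zE yE.
  have /andP[farc /forallP cleanc] := eP c; have /andP[z1 z2] := zP c.
  have /andP[_ nsh] := farc.
  apply/eqP => zk; have [Ek|nk1] := eqVneq k (inl (e c).1).
    by case/negP: nsh; move: z2; rewrite zk Ek.
  have [Ek|nk2] := eqVneq k (inr (e c).2).
    by case/negP: nsh; move: z1; rewrite zk Ek.
  by have := cleanc k; rewrite nk1 nk2 -zk (share_refl _ _ z1).
- apply/forallP => k; apply: ltnW.
  by case/andP: reg_w => /forallP/(_ ([ffun k => y (q k)] k)).
- apply/forallP => c; rewrite zE !yE; have /andP[/andP[_ nsh] _] := eP c.
  have /andP[/existsP[l /and3P[lN l1 l2]] /existsP[l' /and3P[l'N l'1 l'2]]] := zP c.
  apply/existsP; exists (l, l'); rewrite /= l1 l'2 l2 l'1 !andbT.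
  apply: contra nsh => /eqP E; apply/existsP; exists l.
  by rewrite lN l1 E.
Qed.

Let prob_far i j :
  prob (fun q : {ffun 'I_h + 'I_h -> 'I_m} => far (q (inl i)) (q (inr j))) =
  #|[pred p | far p.1 p.2]|%:R / m%:R ^+ 2.
Proof.
pose P (p : 'I_m * 'I_m) (q : {ffun 'I_h + 'I_h -> 'I_m}) :=
  (q (inl i) == p.1) && (q (inr j) == p.2).
have prP p : prob (P p) = m%:R ^- 2.
  pose A (k : 'I_h + 'I_h) : pred 'I_m := pred1 (if k is inl _ then p.1 else p.2).
  transitivity (prob (fun q : {ffun 'I_h + 'I_h -> 'I_m} =>
     [forall k in [set inl i; inr j], A k (q k)])).
    congr (_%:R / _); apply: eq_card => q; rewrite !unfold_in.
    apply/andP/forall_inP => [[/eqP q1 /eqP q2] k|Hq].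
      by rewrite !inE => /orP[] /eqP ->; rewrite /A /= ?q1 ?q2 eqxx.
    by split; [apply: (Hq (inl i)) | apply: (Hq (inr j))]; rewrite !inE eqxx ?orbT.
  rewrite prob_cylinder ?card_ord //.
  rewrite (eq_bigr (fun=> m%:R^-1 : rat)) => [|k _]; last first.
    by rewrite (_ : #|A k| = 1%N) ?card1 ?card_ord ?mul1r // (card1 (if k is inl _ then p.1 else p.2)).
  by rewrite prodr_const cards2 /= exprVn.
rewrite -sum1_card natr_sum mulr_suml.
under [RHS]eq_bigr => p _ do rewrite mul1r -(prP p) probE.
rewrite -mulr_suml probE; congr (_ / _); rewrite exchange_big /=.
apply: eq_bigr => q _; rewrite big_mkcond /= (bigD1 (q (inl i), q (inr j))) //=.
rewrite [X in _ + X]big1 => [|p np]; last first.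
  case: ifP => // _; rewrite /P; case: eqP => //= e1; case: eqP => //= e2.
  by rewrite e1 e2 -surjective_pairing eqxx in np.
by rewrite /P unfold_in /= !eqxx addr0; case: (far _ _).
Qed.

(** A far pair is a close pair without a common block.  Sample [h + h] of the
    [m] points at random.  A far pair of sampled points is clean when no other
    sampled point shares a block with its midpoint; this has conditional
    probability at least 1/2 because such points are at most [D], a small
    fraction of all.  Clean pairs form a configuration, hence there are always
    fewer than [v] of them, and the expectation bounds the number of far
    pairs. *)
Lemma few_far_pairs : (h * h * #|[pred p | far p.1 p.2]| <= 2 * v * m ^ 2)%N.
Proof.
pose Sm := {ffun 'I_h + 'I_h -> 'I_m}.
have m0 : 0 < m%:R :> rat by rewrite ltr0n.
have Om_gt0 : 0 < #|{: Sm}|%:R :> rat.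
  by rewrite ltr0n card_ffun card_ord expn_gt0 m_gt0.
pose fr := #|[pred p | far p.1 p.2]|%:R / m%:R ^+ 2 : rat.
have fr0 : 0 <= fr by rewrite divr_ge0 ?exprn_ge0.
have clean_ge i j : fr / 2 <= prob (clean i j).
  pose hit k (q : Sm) := far (q (inl i)) (q (inr j)) &&
     share s w N (mid (q (inl i)) (q (inr j))) (y (q k)).
  pose K := [pred k : 'I_h + 'I_h | (k != inl i) && (k != inr j)].
  have hit_le k : K k -> prob (hit k) <= D%:R / m%:R * fr.
    move=> /andP[nk1 nk2]; rewrite /fr -(prob_far i j).
    have mix1 q q' : mix [set k] q' q (inl i) = q (inl i) :> 'I_m.
      by rewrite ffunE inE eq_sym (negbTE nk1).
    have mix2 q q' : mix [set k] q' q (inr j) = q (inr j) :> 'I_m.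
      by rewrite ffunE inE eq_sym (negbTE nk2).
    have mixk q q' : mix [set k] q' q k = q' k :> 'I_m.
      by rewrite ffunE inE eqxx.
    apply: (prob_resample (S := [set k])).
    - by move=> q /andP[].
    - by move=> q q'; rewrite mix1 mix2.
    - move=> q _; set x := mid (q (inl i)) (q (inr j)).
      apply: le_trans (_ : prob (fun q' : Sm =>
        [forall k' in [set k], [pred a | share s w N x (y a)] (q' k')]) <= _).
        apply: prob_mono => q' /andP[_]; rewrite mix1 mix2 mixk => Hx.
        by apply/forall_inP => k'; rewrite inE => /eqP ->.
      apply: le_trans (prob_cylinder_le (S := [set k]) (p := D%:R / m%:R)
        (A := fun _ => [pred a | share s w N x (y a)]) _ _) _.
      + by rewrite card_ord.
      + by move=> k' _; rewrite card_ord ler_wpM2r ?invr_ge0 // ler_nat share_y.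
      + by rewrite cards1 expr1.
  have le_fr : fr <= prob (clean i j) + prob (fun q => [exists k, K k && hit k q]).
    rewrite /fr -(prob_far i j).
    apply: le_trans (prob_or (clean i j) (fun q => [exists k, K k && hit k q])).
    apply: prob_mono => q fq.
    have [//|] := boolP (clean i j q); rewrite /clean fq /= => /forallPn[k].
    rewrite negb_imply negbK => /andP[Kk sk]; apply/existsP; exists k.
    by rewrite Kk /hit fq sk.
  have p0 : 0 <= D%:R / m%:R * fr by exact: mulr_ge0 (divr_ge0 (ler0n _ _) (ler0n _ _)) fr0.
  have := prob_exists_in p0 hit_le => le_hit.
  have le_K : #|K|%:R * (D%:R / m%:R * fr) <= fr / 2.
    apply: le_trans (_ : (h + h)%:R * (D%:R / m%:R * fr) <= _).
      rewrite ler_wpM2r // ler_nat; apply: leq_trans (max_card _) _.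
      by rewrite card_sum !card_ord.
    rewrite mulrA [fr / 2]mulrC ler_wpM2r // mulrA ler_pdivrMr //.
    have : (4 * h * D)%:R <= m%:R :> rat by rewrite ler_nat.
    by rewrite !natrM natrD; lra.
  by lra.
have le_v : \sum_i \sum_j prob (clean i j) <= v%:R.
  rewrite pair_bigA /=.
  under eq_bigr do rewrite probE.
  rewrite -mulr_suml ler_pdivrMr // exchange_big /= mulr_natr.
  rewrite -[X in v%:R *+ X]/(#|{: Sm}|) -sumr_const; apply: ler_sum => q _.
  apply: le_trans (_ : #|[pred p | clean p.1 p.2 q]|%:R <= _).
    rewrite -sum1_card natr_sum [leRHS]big_mkcond ler_sum // => p _.
    by rewrite unfold_in /=; case: (clean _ _ _).
  by rewrite ler_nat; exact: ltnW (few_clean q).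
have : \sum_(i < h) \sum_(j < h) fr / 2 <= v%:R.
  apply: le_trans le_v; apply: ler_sum => i _.
  by apply: ler_sum => j _.
rewrite !sumr_const !card_ord -mulrnA -[X in X <= _]mulr_natl mulrA ler_pdivrMr // /fr mulrA.
rewrite ler_pdivrMr ?exprn_gt0 // -natrX -!natrM ler_nat.
by rewrite [(2 * v)%N]mulnC.
Qed.

(** Pairs with equal images or with a common block are few for the trivial
    reason that each point has few partners of these kinds. *)
Lemma few_close_pairs (rho : nat) :
  (forall x, (#|[pred a | y a == x]| <= rho)%N) ->
  (h * h * #|[pred p : 'I_m * 'I_m | (y p.1 == y p.2) || close s w N (y p.1) (y p.2)]|
     <= h * h * (m * rho + m * D) + 2 * v * m ^ 2)%N.
Proof.
move=> le_rho; apply: leq_trans (leq_add (leqnn _) few_far_pairs); rewrite -mulnDr.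
rewrite leq_mul2l; apply/orP; right.
have c1 : (#|[pred p : 'I_m * 'I_m | y p.2 == y p.1]| <= m * rho)%N.
  rewrite (card_pairs (fun a => [pred b | y b == y a])).
  rewrite -[X in (_ <= X * _)%N]card_ord -sum_nat_const; apply: leq_sum => a _; exact: le_rho.
have c2 : (#|[pred p : 'I_m * 'I_m | share s w N (y p.1) (y p.2)]| <= m * D)%N.
  rewrite (card_pairs (fun a => [pred b | share s w N (y a) (y b)])).
  rewrite -[X in (_ <= X * _)%N]card_ord -sum_nat_const; apply: leq_sum => a _; exact: share_y.
apply: leq_trans (leq_add (leq_add c1 c2) (leqnn _)).
rewrite -!sum1_card.
rewrite big_mkcond [X in (_ <= X + _ + _)%N]big_mkcond [X in (_ <= _ + X + _)%N]big_mkcond.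
rewrite [X in (_ <= _ + X)%N]big_mkcond -!big_split leq_sum //= => p _.
rewrite !inE /far eq_sym; case: (y p.2 == _) => //=.
by case: (close _ _ _ _ _); case: (share _ _ _ _ _).
Qed.

End CleanPairs.

(** * Large vertex sets are spread on one of the two sides *)

Lemma card_preim_fibres (V B : finType) (f : V -> B) (P : pred B) (rho : nat) :
  (forall x, (#|[pred v | f v == x]| <= rho)%N) ->
  (#|[pred v | P (f v)]| <= #|P| * rho)%N.
Proof.
move=> le_rho; rewrite -sum_nat_const.
apply: leq_trans (_ : \sum_(x in P) #|[pred v | f v == x]| <= _)%N; last exact: leq_sum.
under eq_bigr do rewrite -sum1_card big_mkcond.
rewrite exchange_big /= -sum1_card big_mkcond leq_sum // => v _.
rewrite unfold_in /=; case: ifP => // Pv.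
by rewrite (bigD1 (f v)) //= unfold_in /= eqxx.
Qed.

Lemma card_comp_inj (A V : finType) (e : A -> V) (P : pred V) :
  injective e -> (#|[pred a | P (e a)]| <= #|P|)%N.
Proof.
move=> e_inj; rewrite -(card_imset _ e_inj); apply: subset_leq_card.
by apply/fintype.subsetP => v /imsetP[a]; rewrite !inE => Pa ->.
Qed.

Lemma cover_by_seq (B : finType) (A : {set B}) (m : nat) :
  (0 < #|A|)%N -> (#|A| <= m)%N ->
  exists a : {ffun 'I_m -> B}, {subset A <= codom a}.
Proof.
move=> /card_gt0P[x0 _] le_m; exists [ffun i : 'I_m => nth x0 (enum A) i] => x Ax.
have lt_i : (index x (enum A) < m)%N.
  by apply: leq_trans le_m; rewrite cardE index_mem mem_enum.
apply/codomP; exists (Ordinal lt_i); rewrite ffunE /= nth_index //.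
by rewrite mem_enum.
Qed.

Section Spread.
Variables (V B : finType) (g : V -> B) (m r : nat).
Hypothesis m_gt0 : (0 < m)%N.
Hypothesis B_gt0 : (0 < #|B|)%N.
Hypothesis g_fibre : forall x, (#|[pred v | g v == x]| <= r)%N.

(** The fibres of both maps may contain many vertices, and a set is useful on a
    side only through its distinct images there. *)
Definition spread (f : {ffun V -> B}) :=
  [forall S : {set V}, (16 * m <= #|S|)%N ==>
     (m <= #|f @: S|)%N || (m <= #|g @: S|)%N].

(** A set that is not spread lies over fewer than [m] points on both sides,
    that is, in a set of at most [m * r] vertices (known from [g]) that the
    random [f] sends to a prescribed set of [m] points. *)
Lemma prob_not_spread :
  prob (fun f => ~~ spread f) <=
    #|B|%:R ^+ (2 * m) * ((r * m)%:R / (4 * #|B|%:R)) ^+ (16 * m).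
Proof.
pose Y (b : {ffun 'I_m -> B}) := [set v | g v \in codom b].
pose p : rat := m%:R / #|B|%:R.
have B0 : 0 < #|B|%:R :> rat by rewrite ltr0n.
have p0 : 0 <= p by rewrite divr_ge0.
pose E (ab : {ffun 'I_m -> B} * {ffun 'I_m -> B}) (f : {ffun V -> B}) :=
  (16 * m <= #|[set v in Y ab.2 | f v \in codom ab.1]|)%N.
have cod_le (a : {ffun 'I_m -> B}) : (#|codom a| <= m)%N.
  by apply: leq_trans (card_size _) _; rewrite size_codom card_ord.
apply: le_trans (_ : prob (fun f => [exists ab, E ab f]) <= _).
  apply: prob_mono => f /forallPn[S]; rewrite negb_imply negb_or -!ltnNge.
  case/and3P=> leS ltf ltg.
  have [v0 Sv0] : exists v, v \in S.
    by apply/card_gt0P; apply: leq_trans leS; rewrite muln_gt0.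
  have f0 : (0 < #|f @: S|)%N by apply/card_gt0P; exists (f v0); apply: imset_f.
  have g0 : (0 < #|g @: S|)%N by apply/card_gt0P; exists (g v0); apply: imset_f.
  have [a fa] := cover_by_seq f0 (ltnW ltf); have [b gb] := cover_by_seq g0 (ltnW ltg).
  apply/existsP; exists (a, b); apply: leq_trans leS _; apply: subset_leq_card.
  by apply/fintype.subsetP => v Sv; rewrite !inE fa ?gb ?imset_f.
have E_le ab : prob (E ab) <= ((r * m)%:R / (4 * #|B|%:R)) ^+ (16 * m).
  case: ab => a b; rewrite /E /=.
  apply: le_trans (prob_many (A := fun _ => [pred x | x \in codom a]) _ B_gt0 p0 _) _.
    by move=> v _; rewrite ler_wpM2r ?invr_ge0 // ler_nat; apply: cod_le.
  have leY : (#|Y b| <= m * r)%N.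
    rewrite cardsE; apply: leq_trans (card_preim_fibres (mem (codom b)) g_fibre) _.
    by rewrite leq_mul2r cod_le orbT.
  apply: le_trans (_ : 'C(m * r, 16 * m)%:R * p ^+ (16 * m) <= _).
    by rewrite ler_wpM2r ?exprn_ge0 // ler_nat leq_bin2l.
  have a0 : 0 < (16 * m)%:R ^+ (16 * m) :> rat by rewrite exprn_gt0 // ltr0n muln_gt0.
  rewrite -(ler_pM2r a0); apply: le_trans (bin_tail_le _ _ p0) _.
  rewrite -exprMn; apply: lerXn2r; rewrite ?nnegrE.
  - exact: mulr_ge0 (mulr_ge0 (ler0n _ _) (ler0n _ _)) p0.
  - exact: mulr_ge0 (divr_ge0 (ler0n _ _) (mulr_ge0 (ler0n _ 4) (ler0n _ _))) (ler0n _ _).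
  - rewrite le_eqVlt; apply/orP; left; apply/eqP; rewrite /p !natrM; field.
    exact: lt0r_neq0.
apply: le_trans (prob_exists_unif E_le) _.
by rewrite card_prod !card_ffun card_ord -expnD addnn mul2n natrX.
Qed.

Lemma prob_big_fibre :
  (#|V| <= #|B| * r)%N ->
  prob (fun f : {ffun V -> B} => [exists x, (8 * r <= #|[pred v | f v == x]|)%N]) <=
    #|B|%:R * 2^-1 ^+ (8 * r).
Proof.
move=> leV; apply: prob_exists_unif => x.
have B0 : 0 < #|B|%:R :> rat by rewrite ltr0n.
have p0 : 0 <= 1 / #|B|%:R :> rat by rewrite divr_ge0.
apply: le_trans (_ : 'C(#|[set: V]|, 8 * r)%:R * (1 / #|B|%:R) ^+ (8 * r) <= _).
  apply: le_trans (prob_many (A := fun _ => pred1 x) _ B_gt0 p0 _).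
    apply: prob_mono => f /leq_trans; apply; apply: subset_leq_card.
    by apply/fintype.subsetP => v; rewrite !inE.
  by move=> v _; rewrite card1.
apply: bin_tail_half => //; rewrite cardsT mulrA mulr1 ler_pdivrMr // -!natrM ler_nat.
by rewrite -mulnA leq_mul2l mulnC leV.
Qed.

End Spread.

Lemma prob_coord (X T : finType) (P : pred T) (x : X) : (0 < #|T|)%N ->
  prob (fun w : {ffun X -> T} => P (w x)) <= prob P.
Proof.
move=> T0; apply: le_trans (_ : prob (fun w : {ffun X -> T} =>
   [forall x' in [set x], P (w x')]) <= _).
  by apply: prob_mono => w Pw; apply/forall_inP => x'; rewrite inE => /eqP ->.
by rewrite (prob_cylinder _ (fun=> P)) // big_set1.
Qed.

(** * Choosing the two block systems *)

Lemma six_eighths_lt1 : 4^-1 + 8^-1 + (4^-1 + 8^-1) < 1 :> rat.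
Proof. by lra. Qed.

Section TwoSystems.
Variables (N s L : nat) (B V : finType) (m rho ad ab h v phi : nat).
Variable pos : bool -> V -> B.
Hypotheses (L_gt0 : (0 < L)%N) (m_gt0 : (0 < m)%N) (h_gt0 : (0 < h)%N).
Hypothesis le_sL : (s <= L)%N.
Hypothesis pos_fibre : forall c x, (#|[pred u | pos c u == x]| <= rho)%N.
Let Om := block_system N L B.
Let D := (ad * ab * rho)%N.

(** The two properties of a block system that together imply that few pairs
    are close, for every choice of vertices. *)
Definition tame (w : Om) := regular_system s ad ab w && ~~ has_configuration s ad h v w.

Hypothesis hD : (4 * h * D <= m)%N.
Hypothesis h_phi :
  (h * h * (m * rho + m * D) + 2 * v * m ^ 2 <= h * h * phi)%N.

Let bad (sys : bool -> Om) c u u' :=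
  (pos c u == pos c u') || close s (sys c) N (pos c u) (pos c u').

Lemma few_bad_pairs sys c (e : 'I_m -> V) :
  tame (sys c) -> injective e ->
  (#|[pred p : 'I_m * 'I_m | bad sys c (e p.1) (e p.2)]| <= phi)%N.
Proof.
case/andP=> reg noconf e_inj; rewrite -(@leq_pmul2l (h * h)) ?muln_gt0 ?h_gt0 //.
apply: leq_trans h_phi.
apply: (few_close_pairs (y := fun a => pos c (e a)) reg noconf m_gt0 _ hD) => x.
  apply: leq_trans (card_comp_inj (fun u => share s (sys c) N x (pos c u)) e_inj) _.
  apply: leq_trans (card_preim_fibres (share s (sys c) N x) (pos_fibre c)) _.
  by rewrite leq_mul2r (card_share _ reg) orbT.
exact: leq_trans (card_comp_inj (fun u => pos c u == x) e_inj) (pos_fibre c x).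
Qed.

(** All blocks of the side [c] fail on the vertices listed by [e]. *)
Definition misses (sys : bool -> Om) c (e : 'I_m -> V) :=
  [forall l : 'I_N,
    regular_prefix s (fun a => pos c (e a)) phi (ad * ab) (sys c) l &&
    ~~ transversal_block s (fun a => pos c (e a))
         (fun a b => bad sys (~~ c) (e a) (e b)) (sys c) l].

Lemma hits_transversal sys c (e : 'I_m -> V) :
  tame (sys c) -> injective e -> ~~ misses sys c e ->
  exists l, transversal_block s (fun a => pos c (e a))
         (fun a b => bad sys (~~ c) (e a) (e b)) (sys c) l.
Proof.
move=> tame_c e_inj /forallPn[l]; rewrite negb_and negbK => /orP[|]; last by exists l.
case/negP; have le_lN := ltnW (ltn_ord l); apply/andP; split.
  apply: leq_trans (few_bad_pairs tame_c e_inj); apply: subset_leq_card.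
  by apply/fintype.subsetP => p; rewrite !inE /bad => /(close_mono le_lN) ->; rewrite orbT.
apply/forallP => x; case/andP: tame_c => reg _.
apply: leq_trans (card_share x reg); apply: subset_leq_card.
by apply/fintype.subsetP => z; rewrite !unfold_in; apply: share_mono.
Qed.

Lemma transversal_clique sys c (e : 'I_m -> V) l (S : {set two_system_graph s pos sys}) :
  (forall a, e a \in S) ->
  transversal_block s (fun a => pos c (e a))
         (fun a b => bad sys (~~ c) (e a) (e b)) (sys c) l ->
  contains_copy (induced_subgraph S) (complete_graph s).
Proof.
move=> eS /and3P[/forallP lab /forallP ok /forallP nsp].
have [a aP] : exists a : 'I_s -> 'I_m, forall i, sys c (l, pos c (e (a i))) = i :> nat.
  apply: (fin_all_exists (P := fun (i : 'I_s) b => sys c (l, pos c (e b)) = i :> nat)) => i.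
  by have /existsP[b /eqP] := lab i; exists b.
have a_inj i j : e (a i) = e (a j) -> i = j.
  by move=> eq_a; apply: val_inj => /=; rewrite -aP eq_a aP.
have pres i : present s (sys c) l (pos c (e (a i))) by rewrite /present aP.
exists (fun i : 'I_s => exist (fun u => u \in S) (e (a i)) (eS (a i))).
  by move=> i j /(congr1 val) /a_inj.
move=> i j nij /=; rewrite /induced_edge /=; apply/existsP; exists (c, l).
have naij : a i != a j by apply: contra_neq nij => eq_a; apply: a_inj; rewrite eq_a.
have := ok (a i) => /forallP/(_ (a j)); rewrite naij !pres /= negb_or => /andP[nb ncl].
have := nsp (a i); have := nsp (a j); rewrite !pres /= => nsj nsi.
rewrite /col_edge /= nb andbT /block_edge !pres ncl nsi nsj /= andbT.
by rewrite -val_eqE /= !aP.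
Qed.

Let side_bad c (sys : {ffun bool -> Om}) := ~~ tame (sys c) ||
  [&& tame (sys (~~ c)) &
      [exists e : {ffun 'I_m -> V}, [&& injectiveb e, injectiveb (fun a => pos c (e a)) &
         misses sys c e]]].

(** For each side, the other system is fixed first, which fixes the pairs that
    it excludes; then the failure of all blocks is summed over all lists [e]. *)
Lemma exists_two_systems :
  (0 < #|B|)%N ->
  prob (fun w : Om => ~~ tame w) <= 4^-1 ->
  #|V|%:R ^+ m * 2^-1 ^+ N <= 8^-1 :> rat ->
  s%:R * ((L%:R - 1) / L%:R) ^+ m
      + (phi + phi + m * (ad * ab))%:R * (s%:R / L%:R) ^+ 2 <= 2^-1 :> rat ->
  exists sys : bool -> Om, forall c, tame (sys c) /\
    forall e : {ffun 'I_m -> V}, injective (fun a => pos c (e a)) -> ~~ misses sys c e.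
Proof.
move=> B_gt0 small_tame small_union half.
have Om_gt0 : (0 < #|{: Om}|)%N by rewrite card_ffun card_ord expn_gt0 L_gt0.
have nm c : prob (side_bad c) <= 4^-1 + 8^-1.
  apply: le_trans (prob_or (fun sys : {ffun bool -> Om} => ~~ tame (sys c)) _) _.
  apply: lerD.
    exact: le_trans (prob_coord (fun w => ~~ tame w) c Om_gt0) small_tame.
  rewrite -[8^-1]mulr1.
  apply: le_trans (_ : 8^-1 * prob (xpredT : pred {ffun bool -> Om}) <= _); last first.
    by rewrite ler_wpM2l // prob_le1.
  apply: (prob_resample (S := [set c])) => // w _.
  have mixc w' : mix [set c] w' w c = w' c by rewrite ffunE inE eqxx.
  have mixn w' : mix [set c] w' w (~~ c) = w (~~ c).
    by rewrite ffunE inE; case: (c).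
  have [tame_w|ntame] := boolP (tame (w (~~ c))); last first.
    by rewrite probE big1 ?mul0r // => w' _; rewrite mixn (negbTE ntame).
  pose sysw (x : Om) b := if b == c then x else w (~~ c).
  pose P (x : Om) := [exists e : {ffun 'I_m -> V},
     (injectiveb e && injectiveb (fun a => pos c (e a))) && misses (sysw x) c e].
  apply: le_trans (_ : prob (fun w' : {ffun bool -> Om} => P (w' c)) <= _).
    apply: prob_mono => w' /andP[_ /existsP[e /and3P[e1 e2 e3]]].
    apply/existsP; exists e; rewrite e1 e2 /=.
    suff -> : misses (sysw (w' c)) c e = misses (mix [set c] w' w) c e by [].
    rewrite /misses /bad /sysw eqxx mixc mixn.
    by have -> : (~~ c == c) = false by case: (c).
  apply: le_trans (prob_coord P c Om_gt0) _; apply: le_trans small_union.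
  apply: le_trans (prob_exists_in (p := 2^-1 ^+ N) _ _) _.
  - by rewrite exprn_ge0.
  - move=> e /andP[/injectiveP e_inj /injectiveP y_inj].
    pose oth a b := bad (sysw (w (~~ c))) (~~ c) (e a) (e b).
    apply: le_trans (_ : prob (fun x : Om => [forall l : 'I_N,
       regular_prefix s (fun a => pos c (e a)) phi (ad * ab) x l &&
       ~~ transversal_block s (fun a => pos c (e a)) oth x l]) <= _).
      apply: prob_mono => x; rewrite /misses /oth /bad /sysw eqxx.
      by have -> : (~~ c == c) = false by case: (c).
    apply: (@prob_no_transversal _ _ _ _ _ L_gt0 _ _ _ phi phi) => //.
    apply: few_bad_pairs => //; rewrite /sysw.
    by have -> : (~~ c == c) = false by case: (c).
  - rewrite ler_wpM2r ?exprn_ge0 // -natrX ler_nat.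
    by apply: leq_trans (max_card _) _; rewrite card_ffun card_ord.
have [sys] : exists sys : {ffun bool -> Om}, ~~ (side_bad true sys || side_bad false sys).
  apply: prob_lt1_ex; last by rewrite card_ffun expn_gt0 Om_gt0.
  apply: le_lt_trans (prob_or (side_bad true) (side_bad false)) _.
  apply: le_lt_trans (lerD (nm true) (nm false)) _.
  exact: six_eighths_lt1.
case/norP=> ok_t ok_f; have ok b : ~~ side_bad b sys by case: b.
have tame_sys b : tame (sys b) by case/norP: (ok b) => /negPn.
exists sys => c; split=> // e y_inj; apply/negP => miss_e.
case/norP: (ok c) => _ /negP; apply; apply/andP; split=> //; apply/existsP; exists e.
apply/and3P; split=> //; apply/injectiveP => // a b eq_e.
by apply: y_inj; rewrite /= eq_e.
Qed.

End TwoSystems.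

(** * The graph for admissible parameters *)

Lemma injective_subselection (V B : finType) (f : V -> B) (S : {set V}) (m : nat) :
  (m <= #|f @: S|)%N ->
  exists e : {ffun 'I_m -> V}, (forall i, e i \in S) /\ injective (fun i => f (e i)).
Proof.
move=> le_m; pose x (i : 'I_m) := enum_val (widen_ord le_m i).
have [e eP] : exists e : 'I_m -> V, forall i, e i \in S /\ f (e i) = x i.
  apply: (fin_all_exists (P := fun i v => v \in S /\ f v = x i)) => i.
  by have /imsetP[v Sv E] := enum_valP (widen_ord le_m i); exists v; rewrite /x E.
exists (finfun e); split=> [i|i j]; rewrite !ffunE; first by case: (eP i).
by rewrite (proj2 (eP i)) (proj2 (eP j)) => /enum_val_inj /(congr1 val) /= /val_inj.
Qed.

Lemma card_div_fibre (n r x : nat) : (0 < r)%N ->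
  (#|[pred u : 'I_n | (u %/ r)%N == x]| <= r)%N.
Proof.
move=> r0.
have sub : [pred u : 'I_n | (u %/ r)%N == x] \subset (pmap insub (iota (x * r) r) : seq 'I_n).
  apply/fintype.subsetP => u; rewrite inE => /eqP Eu; rewrite mem_pmap_sub mem_iota /=.
  by rewrite -Eu leq_divM -mulSnr ltn_ceil.
apply: leq_trans (subset_leq_card sub) (leq_trans (card_size _) _).
by rewrite size_pmap_sub (leq_trans (count_size _ _)) ?size_iota.
Qed.

(** [N] blocks with labels below [L] on [M] points; [ad] and [ab] bound the
    number of blocks through a point and of points in a block; [h] and [v] are
    the size of half a sample and the number of clean pairs; [phi] bounds the
    number of close pairs; fibres have at most [8 * r] elements. *)
Record admissible (F : realFieldType) (s n N L M m r ad ab h v phi : nat) : Prop :=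
  Admissible {
  labels_suffice : (s <= L)%N;
  m_positive : (0 < m)%N;
  h_positive : (0 < h)%N;
  r_positive : (0 < r)%N;
  n_positive : (0 < n)%N;
  points_cover : (n <= M * r)%N;
  degree_small : (4 * h * (ad * ab * (8 * r)) <= m)%N;
  close_small : (h * h * (m * (8 * r) + m * (ad * ab * (8 * r))) + 2 * v * m ^ 2
                   <= h * h * phi)%N;
  degree_typical : (8 * N * s <= ad * L)%N;
  size_typical : (8 * M * s <= ab * L)%N;
  irregular_rare : M%:R * 2^-1 ^+ ad + N%:R * 2^-1 ^+ ab <= 8^-1 :> F;
  config_rare : (M ^ (h + h) * (h * h) ^ v * M ^ v)%:R
                  * ((ad ^ 2)%:R * (s%:R / L%:R) ^+ 2) ^+ v <= 8^-1 :> F;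
  union_small : n%:R ^+ m * 2^-1 ^+ N <= 8^-1 :> F;
  block_succeeds : s%:R * ((L%:R - 1) / L%:R) ^+ m
      + (phi + phi + m * (ad * ab))%:R * (s%:R / L%:R) ^+ 2 <= 2^-1 :> F;
  spread_likely : M%:R ^+ (2 * m) * ((r * m)%:R / (4 * M%:R)) ^+ (16 * m)
      + M%:R * 2^-1 ^+ (8 * r) < 1 :> F }.

(** The random map is fixed before the block systems are drawn, because the
    events that concern the systems are defined through both maps. *)
Theorem two_system_graph_exists (s n N L M m r ad ab h v phi : nat) :
  (1 < s)%N -> admissible rat s n N L M m r ad ab h v phi ->
  exists G : sgraph, [/\ #|G| = n, free_of (complete_graph s.+1) G &
    forall S : {set G}, (16 * m <= #|S|)%N ->
      contains_copy (induced_subgraph S) (complete_graph s)].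
Proof.
move=> s1 [le_sL m0 h0 r0 n0 leMr hD hphi had hab hreg hconf hunion half hspread].
have L0 : (0 < L)%N by apply: leq_trans le_sL; apply: ltnW.
have lt_g (u : 'I_n) : (u %/ r < M)%N by rewrite ltn_divLR // (leq_trans (ltn_ord u)).
pose g u := Ordinal (lt_g u).
have M0 : (0 < #|'I_M|)%N.
  by rewrite card_ord; case: (M) leMr => //; rewrite mul0n leqNgt n0.
have g_fibre x : (#|[pred u | g u == x]| <= r)%N.
  exact: leq_trans (card_div_fibre n x r0).
have [f] : exists f : {ffun 'I_n -> 'I_M},
    ~~ (~~ spread g m f || [exists x, (8 * r <= #|[pred u | f u == x]|)%N]).
  apply: prob_lt1_ex; last by rewrite card_ffun expn_gt0 M0.
  apply: le_lt_trans (prob_or (fun f => ~~ spread g m f) _) _.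
  have leV : (#|'I_n| <= #|'I_M| * r)%N by rewrite !card_ord.
  apply: le_lt_trans (lerD (prob_not_spread m0 M0 g_fibre) (prob_big_fibre M0 leV)) _.
  by rewrite !card_ord.
rewrite negb_or negbK => /andP[/forallP f_spread /existsPn f_fibre].
pose pos (c : bool) u := if c then f u else g u.
have pos_fibre c x : (#|[pred u | pos c u == x]| <= 8 * r)%N.
  case: c; last by apply: leq_trans (g_fibre x) _; rewrite leq_pmull.
  by rewrite leqNgt; apply: contra (f_fibre x); apply: ltnW.
have small_tame : prob (fun w : block_system N L 'I_M => ~~ tame s ad ab h v w) <= 4^-1.
  rewrite (_ : 4^-1 = 8^-1 + 8^-1 :> rat); last by [].
  apply: le_trans (_ : prob (fun w : block_system N L 'I_M =>
     ~~ regular_system s ad ab w || has_configuration s ad h v w) <= _).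
    by apply: prob_mono => w; rewrite negb_and negbK.
  apply: le_trans (prob_or _ _) _; apply: lerD.
    have hab' : (8 * #|'I_M| * s <= ab * L)%N by rewrite card_ord.
    apply: le_trans (prob_irregular L0 had hab') _; rewrite card_ord; exact: hreg.
  apply: le_trans (prob_has_configuration N s 'I_M ad h v L0) _; rewrite card_ord; exact: hconf.
have [] := @exists_two_systems N s L 'I_M 'I_n m (8 * r) ad ab h v phi pos
  L0 m0 h0 le_sL pos_fibre hD hphi M0 small_tame _ half; first by rewrite card_ord.
move=> sys sysP; exists (two_system_graph s pos sys); split.
- by rewrite /= card_ord.
- exact: two_system_graph_free.
move=> S leS; have [c le_m] : exists c, (m <= #|pos c @: S|)%N.
  have := f_spread S; rewrite leS /= => /orP[le_m|le_m]; [exists true|exists false] => //.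
have [e [eS e_inj]] := injective_subselection le_m.
have [tame_c /(_ e e_inj) no_miss] := sysP c.
have [|l tr] := hits_transversal m0 h0 pos_fibre hD hphi tame_c _ no_miss.
  by move=> a b eq_e; apply: e_inj; rewrite /= eq_e.
exact: transversal_clique eS tr.
Qed.

(** * Inequalities between the parameters *)

Section Inequalities.
Variables (F : realFieldType) (s t l n r M m L ab h z : F).
Hypotheses (s1 : 1 <= s) (t1 : 1 <= t) (l1 : 1 <= l) (n1 : 1 <= n) (r1 : 1 <= r).
Hypotheses (L1 : 1 <= L) (M1 : 1 <= M) (ab0 : 0 <= ab).
Hypothesis t2 : t ^+ 2 <= 16 * s.
Hypothesis Mr : M * r <= 2 * n.
Hypothesis mE : m = t * L.
Hypothesis abL : ab * L <= 16 * (M * s).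
Hypothesis X_le : 2 ^+ 34 * s ^+ 6 * n * l <= m ^+ 2.
Hypothesis hE : h = 2 ^+ 12 * s ^+ 2 * t ^+ 2.
Hypothesis zE : z = 2 ^+ 36 * s ^+ 6 * l.

Let s0 : 0 <= s := le_trans ler01 s1.
Let t0 : 0 <= t := le_trans ler01 t1.
Let l0 : 0 <= l := le_trans ler01 l1.
Let n0 : 0 <= n := le_trans ler01 n1.
Let r0 : 0 <= r := le_trans ler01 r1.
Let L0 : 0 <= L := le_trans ler01 L1.
Let M0 : 0 <= M := le_trans ler01 M1.

Lemma m_pos : 0 < m.
Proof. by rewrite mE mulr_gt0 // (lt_le_trans ltr01). Qed.

Lemma t4_le : t ^+ 4 <= 2 ^+ 8 * s ^+ 2.
Proof.
have -> : t ^+ 4 = (t ^+ 2) ^+ 2 by ring.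
have -> : 2 ^+ 8 * s ^+ 2 = (16 * s) ^+ 2 by ring.
by rewrite lerXn2r ?nnegrE ?exprn_ge0 // mulr_ge0.
Qed.

Lemma t8_le : t ^+ 8 <= 2 ^+ 16 * s ^+ 4.
Proof.
have -> : t ^+ 8 = (t ^+ 4) ^+ 2 by ring.
have -> : 2 ^+ 16 * s ^+ 4 = (2 ^+ 8 * s ^+ 2) ^+ 2 by ring.
by rewrite lerXn2r ?nnegrE ?t4_le ?mulr_ge0 ?exprn_ge0.
Qed.

(** At most [ad * ab] points share a block with a given one, hence at most
    [ad * ab * (8 * r)] vertices do.  This is the only inequality in which
    the order of magnitude of [m] is sharp: up to constants it says that
    [m ^+ 2] is at least [s ^+ 4 * t ^+ 4 * n * l]. *)
Lemma degree_bound : 4 * h * (16 * s * t * l * ab * (8 * r)) <= m.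
Proof.
rewrite -(ler_pM2r m_pos) -expr2; apply: le_trans X_le.
have -> : 4 * h * (16 * s * t * l * ab * (8 * r)) * m =
    (2 ^+ 21 * s ^+ 3 * t ^+ 4 * l) * (r * (ab * L)) by rewrite mE hE; ring.
have le1 : r * (ab * L) <= 32 * s * n.
  apply: le_trans (ler_wpM2l r0 abL) _.
  have -> : r * (16 * (M * s)) = 16 * s * (M * r) by ring.
  have -> : 32 * s * n = 16 * s * (2 * n) by ring.
  by rewrite ler_wpM2l // mulr_ge0.
apply: le_trans (ler_wpM2l _ le1) _; first by rewrite !mulr_ge0 ?exprn_ge0.
have -> : 2 ^+ 21 * s ^+ 3 * t ^+ 4 * l * (32 * s * n) =
  (2 ^+ 26 * s ^+ 4 * l * n) * t ^+ 4 by ring.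
apply: le_trans (ler_wpM2l _ t4_le) _; first by rewrite !mulr_ge0 ?exprn_ge0.
by rewrite le_eqVlt; apply/orP; left; apply/eqP; ring.
Qed.

(** The budget for close pairs is a sixteenth of [L ^+ 2 / s ^+ 2]; the clean
    pairs use 5/256 of that quotient and the other terms far less. *)
Lemma close_pairs_bound (D phi : F) :
  4 * h * D <= m -> L ^+ 2 <= 16 * s ^+ 2 * (phi + 1) ->
  2 ^+ 13 * r * s ^+ 2 * t ^+ 2 <= m -> 2 ^+ 10 * s ^+ 2 <= L ^+ 2 ->
  h * h * (m * (8 * r) + m * D) + 2 * (40 * h) * m ^+ 2 <= h * h * phi.
Proof.
move=> hD hphi hr hL.
have sp : 0 < s by rewrite (lt_le_trans ltr01).
have tp : 0 < t by rewrite (lt_le_trans ltr01).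
have h0 : 0 < h by rewrite hE !mulr_gt0 ?exprn_gt0.
have m0 := m_pos.
pose Q := L ^+ 2 / s ^+ 2.
have LQ : L ^+ 2 = Q * s ^+ 2 by rewrite /Q divfK // expf_neq0 // lt0r_neq0.
have s2p : 0 < s ^+ 2 by rewrite exprn_gt0.
have st2p : 0 < s ^+ 2 * t ^+ 2 by rewrite mulr_gt0 ?exprn_gt0.
have m2 : m ^+ 2 = Q * (s ^+ 2 * t ^+ 2) by rewrite mE exprMn LQ; ring.
have q1 : Q <= 16 * (phi + 1).
  by rewrite -(ler_pM2r s2p) -LQ (le_trans hphi) // le_eqVlt; apply/orP; left; apply/eqP; ring.
have q2 : 2 ^+ 10 <= Q by rewrite -(ler_pM2r s2p) -LQ.
have q3 : m * (8 * r) <= Q / 2 ^+ 10.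
  rewrite ler_pdivlMr ?exprn_gt0 // -(ler_pM2r st2p) -m2.
  have -> : m * (8 * r) * 2 ^+ 10 * (s ^+ 2 * t ^+ 2) = m * (2 ^+ 13 * r * s ^+ 2 * t ^+ 2) by ring.
  by rewrite expr2 ler_wpM2l // ltW.
have q4 : m * D <= Q / 2 ^+ 14.
  rewrite ler_pdivlMr ?exprn_gt0 // -(ler_pM2r st2p) -m2.
  have -> : m * D * 2 ^+ 14 * (s ^+ 2 * t ^+ 2) = m * (4 * h * D) by rewrite hE; ring.
  by rewrite expr2 ler_wpM2l // ltW.
have q5 : 80 * m ^+ 2 = h * (80 / 2 ^+ 12 * Q) by rewrite m2 hE; field.
have -> : 2 * (40 * h) * m ^+ 2 = h * (80 * m ^+ 2) by ring.
rewrite q5.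
have -> : h * h * (m * (8 * r) + m * D) + h * (h * (80 / 2 ^+ 12 * Q)) =
    h * h * (m * (8 * r) + m * D + 80 / 2 ^+ 12 * Q) by ring.
rewrite ler_wpM2l //; first by rewrite mulr_ge0 // ltW.
move: q1 q2 q3 q4; set A := m * (8 * r); set A' := m * D.
have -> : (2 : F) ^+ 10 = 1024 by ring.
have -> : (2 : F) ^+ 14 = 16384 by ring.
have -> : (2 : F) ^+ 12 = 4096 by ring.
by lra.
Qed.

Lemma many_rows_slack : z <= r -> r ^+ 4 <= m -> 2 ^+ 13 * r * s ^+ 2 * t ^+ 2 <= m.
Proof.
move=> zr rm; apply: le_trans rm.
apply: le_trans (_ : r * z <= _).
  have -> : 2 ^+ 13 * r * s ^+ 2 * t ^+ 2 = r * (2 ^+ 13 * s ^+ 2 * t ^+ 2) by ring.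
  rewrite ler_wpM2l // zE; apply: le_trans (ler_wpM2l _ t2) _.
    by rewrite mulr_ge0 ?exprn_ge0.
  have -> : 2 ^+ 13 * s ^+ 2 * (16 * s) = 2 ^+ 17 * s ^+ 3 by ring.
  rewrite -[leLHS]mulr1; apply: ler_pM; rewrite ?mulr_ge0 ?exprn_ge0 //.
  by apply: ler_pM; rewrite ?exprn_ge0 // ler_weXn2l // ler1n.
apply: le_trans (ler_wpM2l r0 zr) _.
by rewrite -expr2 ler_weXn2l.
Qed.

Lemma many_labels_slack : 2 ^+ 10 * s ^+ 2 <= L ^+ 2.
Proof.
have t2p : 0 < t ^+ 2 by rewrite exprn_gt0 // (lt_le_trans ltr01).
rewrite -(ler_pM2r t2p); have -> : L ^+ 2 * t ^+ 2 = m ^+ 2 by rewrite mE; ring.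
apply: le_trans X_le; apply: le_trans (ler_wpM2l _ t2) _.
  by rewrite mulr_ge0 ?exprn_ge0.
have -> : 2 ^+ 10 * s ^+ 2 * (16 * s) = 2 ^+ 14 * s ^+ 3 by ring.
rewrite -[leLHS]mulr1; apply: ler_pM; rewrite ?mulr_ge0 ?exprn_ge0 //.
rewrite -[leLHS]mulr1; apply: ler_pM; rewrite ?mulr_ge0 ?exprn_ge0 //.
by apply: ler_pM; rewrite ?exprn_ge0 // ler_weXn2l // ler1n.
Qed.

(** With [M] points, [z / r] bounds the expected number of midpoints of a
    given pair, including the choice of the pair among [h ^+ 2]. *)
Lemma config_ratio_bound :
  h ^+ 2 * M * (16 * s * t * l) ^+ 2 * (s / L) ^+ 2 * r <= z.
Proof.
have m0 := m_pos.
have Lp : 0 < L by rewrite (lt_le_trans ltr01).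
have m2p : 0 < m ^+ 2 by rewrite exprn_gt0.
rewrite -(ler_pM2r m2p).
have -> : h ^+ 2 * M * (16 * s * t * l) ^+ 2 * (s / L) ^+ 2 * r * m ^+ 2 =
    2 ^+ 32 * s ^+ 8 * l ^+ 2 * t ^+ 8 * (M * r).
  by rewrite mE hE; field; rewrite lt0r_neq0.
apply: le_trans (_ : 2 ^+ 32 * s ^+ 8 * l ^+ 2 * t ^+ 8 * (2 * n) <= _).
  by rewrite ler_wpM2l // !mulr_ge0 ?exprn_ge0.
have -> : 2 ^+ 32 * s ^+ 8 * l ^+ 2 * t ^+ 8 * (2 * n) =
  (2 ^+ 33 * s ^+ 8 * l ^+ 2 * n) * t ^+ 8 by ring.
apply: le_trans (ler_wpM2l _ t8_le) _; first by rewrite !mulr_ge0 ?exprn_ge0.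
apply: le_trans (_ : z * (2 ^+ 34 * s ^+ 6 * n * l) <= _); last first.
  by rewrite ler_wpM2l // zE !mulr_ge0 ?exprn_ge0.
rewrite zE.
have -> : 2 ^+ 33 * s ^+ 8 * l ^+ 2 * n * (2 ^+ 16 * s ^+ 4) =
   2 ^+ 49 * (s ^+ 12 * l ^+ 2 * n) by ring.
have -> : 2 ^+ 36 * s ^+ 6 * l * (2 ^+ 34 * s ^+ 6 * n * l) =
   2 ^+ 70 * (s ^+ 12 * l ^+ 2 * n) by ring.
by rewrite ler_wpM2r ?mulr_ge0 ?exprn_ge0 // ler_weXn2l // ler1n.
Qed.

(** The ratio is at most [r ^- (1/2)], so the factor for [40 * hn] midpoints
    is at most [r ^- (20 * hn)], which beats the [M ^+ (hn + hn)] choices of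
    the sample, as [M] is at most about [r ^+ 8]. *)
Lemma config_bound (theta : F) (hn : nat) :
  0 <= theta -> theta * r <= z -> z ^+ 2 <= r -> M <= 2 ^+ 8 * r ^+ 8 ->
  2 ^+ 16 <= r -> (0 < hn)%N ->
  M ^+ (hn + hn) * theta ^+ (40 * hn) <= 8^-1.
Proof.
move=> th0 th_r zr Mle r16 hn0.
have rp : 0 < r by rewrite (lt_le_trans ltr01).
have th2 : theta ^+ 2 <= r^-1.
  rewrite -[r^-1]mul1r ler_pdivlMr // -(ler_pM2r rp) mul1r.
  have -> : theta ^+ 2 * r * r = (theta * r) ^+ 2 by ring.
  apply: le_trans zr; rewrite lerXn2r ?nnegrE ?mulr_ge0 //.
  exact: le_trans (mulr_ge0 th0 r0) th_r.
have -> : M ^+ (hn + hn) * theta ^+ (40 * hn) = (M ^+ 2 * (theta ^+ 2) ^+ 20) ^+ hn.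
  by rewrite exprMn -!exprM addnn mul2n.
have b1 : M ^+ 2 * (theta ^+ 2) ^+ 20 <= 8^-1.
  apply: le_trans (_ : r ^+ 17 * (r^-1) ^+ 20 <= _).
    apply: ler_pM; rewrite ?exprn_ge0 //.
      apply: le_trans (_ : (2 ^+ 8 * r ^+ 8) ^+ 2 <= _).
        by rewrite lerXn2r ?nnegrE ?mulr_ge0 ?exprn_ge0.
      have -> : (2 ^+ 8 * r ^+ 8) ^+ 2 = 2 ^+ 16 * r ^+ 16 by ring.
      by rewrite [leRHS]exprS ler_wpM2r ?exprn_ge0.
    by rewrite lerXn2r ?nnegrE ?exprn_ge0 ?invr_ge0.
  have -> : r ^+ 17 * r^-1 ^+ 20 = (r ^+ 3)^-1 by field; rewrite lt0r_neq0.
  rewrite lef_pV2 ?posrE ?exprn_gt0 //.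
  have -> : (8 : F) = 2 ^+ 3 by ring.
  rewrite lerXn2r ?nnegrE //; apply: le_trans r16.
  by rewrite -[leLHS]expr1 ler_weXn2l // ler1n.
have b0 : 0 <= M ^+ 2 * (theta ^+ 2) ^+ 20 by rewrite mulr_ge0 ?exprn_ge0.
apply: le_trans (_ : 8^-1 ^+ hn <= _).
  by rewrite lerXn2r ?nnegrE // invr_ge0.
rewrite -[leRHS]expr1 ler_wiXn2l // ?invr_ge0 //.
by rewrite invf_le1 // ler1n.
Qed.

End Inequalities.

(** * Admissible parameters exist *)

Lemma sqr_le_exp2 t : (t ^ 2 <= 2 ^ t.+1)%N.
Proof.
elim: t => [//|t IHt]; have [t3|t3] := leqP 3 t; last by case: t t3 {IHt} => [|[|[|]]].
rewrite expnS; apply: leq_trans (leq_mul (leqnn 2) IHt); nia.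
Qed.

(** Bernoulli's inequality, cleared of denominators. *)
Lemma pow_pred_half (F : realFieldType) (L : nat) : (0 < L)%N ->
  ((L%:R - 1) / L%:R) ^+ L <= 2^-1 :> F.
Proof.
move=> L0; have Lp : 0 < L%:R :> F by rewrite ltr0n.
case: L L0 Lp => // k _ Lp.
have -> : (k.+1%:R - 1) / k.+1%:R = k%:R / k.+1%:R :> F by rewrite -natr1 addrK.
rewrite expr_div_n ler_pdivrMr ?exprn_gt0 // -!natrX ler_pdivlMl // -natrM ler_nat.
have bern j : ((k + j) * k ^ j <= k * k.+1 ^ j)%N.
  elim: j => [|j IHj]; first by rewrite addn0.
  by rewrite !expnS; move: IHj; set a := (k ^ j)%N; set b := (k.+1 ^ j)%N => IHj; nia.
have [->|k0] := posnP k; first by rewrite exp0n.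
rewrite -(leq_pmul2l k0); apply: leq_trans (bern k.+1); rewrite mulnA leq_mul2r.
by apply/orP; right; lia.
Qed.

(** Here [t] is about the logarithm of [s]; the cruder bound by the square root
    of [s] is what makes [t ^ 4] comparable to [s ^ 2]. *)
Lemma exists_label_exponent s : (1 < s)%N ->
  exists t, [/\ (0 < t)%N, (4 * s <= 2 ^ t)%N & (t ^ 2 <= 16 * s)%N].
Proof.
move=> s1; have s4 : (1 < 4 * s)%N by lia.
case/andP: (up_log_bounds (isT : (1 < 2)%N) s4); set t := up_log 2 _ => lo hi.
have t0 : (0 < t)%N by rewrite lt0n; apply: contraTneq hi => ->; rewrite expn0; lia.
exists t; split=> //; apply: leq_trans (sqr_le_exp2 t) _.
by rewrite -{1}(prednK t0) !expnS; lia.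
Qed.

Lemma exists_eighth_root n : (0 < n)%N -> exists r, [/\ (r ^ 8 <= n)%N,
  forall r', (r' ^ 8 <= n)%N -> (r' <= r)%N & (n < (2 * r) ^ 8)%N].
Proof.
move=> n0; have ex : exists r, (r ^ 8 <= n)%N by exists 0%N.
have bd r' : (r' ^ 8 <= n)%N -> (r' <= n)%N.
  by apply: leq_trans; case: r' => // r'; rewrite -{1}[r'.+1]expn1 leq_pexp2l.
exists (ex_maxn ex bd); case: ex_maxnP => r r_le r_max; split=> //.
have r0 : (0 < r)%N by apply: r_max; rewrite exp1n.
by rewrite ltnNge; apply/negP => /r_max; lia.
Qed.

(** Everything is compared with powers of [r]: [m ^ 2] exceeds [n] at most by
    the factor [z], which is at most the root of [r], while [M] is at least
    [n / r] and [n] is at least [r ^ 8]. *)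
Lemma spread_bound (r m z n M : nat) :
  (0 < r)%N -> (r ^ 8 <= n)%N -> (z ^ 2 <= r)%N -> (m ^ 2 <= z * n)%N -> (n <= M * r)%N ->
  ((r * m) ^ 16 <= M ^ 14)%N.
Proof.
move=> r0 rn zr mzn nM.
have r14 : (0 < r ^ 14)%N by rewrite expn_gt0 r0.
rewrite -(leq_pmul2r r14) -expnMn.
apply: leq_trans (_ : n ^ 14 <= _)%N; last by rewrite leq_exp2r.
have -> : ((r * m) ^ 16 = (r ^ 2 * m ^ 2) ^ 8)%N by rewrite -expnMn -expnM.
apply: leq_trans (_ : (r ^ 2 * (z * n)) ^ 8 * r ^ 14 <= _)%N.
  by rewrite leq_mul2r leq_exp2r // leq_mul2l mzn !orbT.
rewrite (_ : (n ^ 14 = n ^ 6 * n ^ 8)%N); last by rewrite -expnD.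
rewrite mulnA expnMn mulnAC leq_mul2r; apply/orP; right.
apply: leq_trans (_ : (r ^ 8) ^ 6 <= _)%N; last by rewrite leq_exp2r.
rewrite expnMn mulnAC -!expnM -expnD.
apply: leq_trans (_ : r ^ (2 * 8 + 14) * r ^ 4 <= _)%N.
  have -> : (z ^ 8 = (z ^ 2) ^ 4)%N by rewrite -expnM.
  by rewrite leq_mul2l leq_exp2r // zr orbT.
by rewrite -expnD leq_pexp2l.
Qed.

Lemma natr_halves_le (F : realFieldType) (k K a : nat) : (0 < k)%N -> (k * K <= 2 ^ a)%N ->
  K%:R * 2^-1 ^+ a <= k%:R^-1 :> F.
Proof.
move=> k0 le_a; have a0 : 0 < 2 ^+ a :> F by rewrite exprn_gt0.
have kp : 0 < k%:R :> F by rewrite ltr0n.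
by rewrite exprVn ler_pdivrMr // ler_pdivlMl // -natrX -natrM ler_nat.
Qed.

Lemma degree_exponent_slack (a b : nat) : (0 < a)%N -> (0 < b)%N -> (4 + b <= 16 * a * b)%N.
Proof. by nia. Qed.

Lemma size_exponent_slack (l r q : nat) :
  (l <= r)%N -> (r <= q)%N -> (5 + (l + l) <= 8 * q.+1)%N.
Proof. by lia. Qed.

Section ParameterChoice.
Variables (F : realFieldType) (s n c12 c16 c34 : nat).
Hypothesis s1 : (1 < s)%N.
Hypothesis c16_ge16 : (16 <= c16)%N.
Hypothesis c16_le : (c16 <= c34)%N.
Hypothesis c12_gt0 : (0 < c12)%N.
Hypothesis c12E : c12%:R = 2 ^+ 12 :> F.
Hypothesis c16E : c16%:R = 2 ^+ 16 :> F.
Hypothesis c34E : c34%:R = 2 ^+ 34 :> F.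
Let lg := up_log 2 n.
Hypothesis z_le : ((4 * c34 * s ^ 6 * lg) ^ 16 <= n)%N.
Hypothesis lg_gt0 : (0 < lg)%N.

(** The number [m = t * L] is the least multiple of [t] with
    [c34 * s ^ 6 * n * lg <= m ^ 2].  Then a label is missed by [m] points with
    probability at most [2 ^ - t], at most a quarter of [1 / s].  The powers of
    two are kept symbolic, since their unary expansions are too large. *)
Lemma exists_admissible : exists m N L M r ad ab h v phi,
  (m ^ 2 <= 4 * (c34 * s ^ 6 * n * lg))%N /\
  admissible F s n N L M m r ad ab h v phi.
Proof.
have s0 : (0 < s)%N by apply: ltnW.
have c16_ge2 : (2 <= c16)%N by apply: leq_trans c16_ge16.
have c16_gt0 : (0 < c16)%N by apply: leq_trans c16_ge2.
have c34_gt0 : (0 < c34)%N by apply: leq_trans c16_le.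
have c16_le4 : (c16 <= 4 * c34)%N by apply: leq_trans c16_le _; rewrite leq_pmull.
have [z zE] : exists z, z = (4 * c34 * s ^ 6 * lg)%N by exists (4 * c34 * s ^ 6 * lg)%N.
have z16 : (c16 <= z)%N.
  rewrite zE -mulnA -[leqLHS]muln1; apply: leq_mul => //.
  by rewrite muln_gt0 expn_gt0 s0.
have z0 : (0 < z)%N by apply: leq_trans z16.
have n_gt0 : (0 < n)%N by apply: leq_trans z_le; rewrite expn_gt0 -zE z0.
have n_gt1 : (1 < n)%N.
  by rewrite ltn_neqAle n_gt0 andbT; apply: contraTneq lg_gt0 => E; rewrite /lg -E up_log1.
have n_lg : (n <= 2 ^ lg)%N by case/andP: (up_log_bounds (isT : (1 < 2)%N) n_gt1).
have [t [t0 st t2]] := exists_label_exponent s1.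
have [r [r_le r_gt n_lt]] := exists_eighth_root n_gt0.
have zr : (z ^ 2 <= r)%N by apply: r_gt; rewrite -expnM zE.
have z_le_r : (z <= r)%N by apply: leq_trans zr; rewrite -{1}[z]expn1 leq_pexp2l.
have r0 : (0 < r)%N by apply: leq_trans z_le_r.
have r16 : (c16 <= r)%N by apply: leq_trans z_le_r.
have lg_le_z : (lg <= z)%N by rewrite zE leq_pmull // muln_gt0 expn_gt0 s0 andbT muln_gt0.
have r_le_n : (r <= n)%N.
  by apply: leq_trans r_le; rewrite -{1}[r]expn1 leq_pexp2l.
have [M [nM Mr]] : exists M, (n <= M * r)%N /\ (M * r <= 2 * n)%N.
  exists (n %/ r).+1; split; first by rewrite ltnW // ltn_ceil.
  by rewrite mulSn mul2n -addnn leq_add // leq_divM.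
have M0 : (0 < M)%N by case: (M) nM => //; rewrite mul0n leqNgt n_gt0.
have r_gt2 : (2 <= r)%N.
  exact: leq_trans r16.
have M_le_n : (M <= n)%N.
  rewrite -(leq_pmul2l (isT : (0 < 2)%N)); apply: leq_trans Mr; rewrite mulnC leq_mul2l.
  by rewrite r_gt2 orbT.
have [X XE] : exists X, X = (c34 * s ^ 6 * n * lg)%N by exists (c34 * s ^ 6 * n * lg)%N.
have X0 : (0 < X)%N by rewrite XE muln_gt0 lg_gt0 andbT muln_gt0 n_gt0 andbT muln_gt0 c34_gt0 expn_gt0 s0.
have [L [X_le L_min]] : exists L, (X <= (t * L) ^ 2)%N /\
    forall L', (X <= (t * L') ^ 2)%N -> (L <= L')%N.
  have ex : exists L, (X <= (t * L) ^ 2)%N.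
    exists X; apply: leq_trans (_ : (t * X) ^ 1 <= _)%N; first by rewrite expn1 leq_pmull.
    by rewrite leq_pexp2l // muln_gt0 t0.
  by exists (ex_minn ex); case: ex_minnP.
have [m mE] : exists m, m = (t * L)%N by exists (t * L)%N.
have s_le_L : (s <= L)%N.
  rewrite -(leq_pmul2l t0) -(@leq_exp2r _ _ 2) //; apply: leq_trans X_le; rewrite XE -mulnA.
  rewrite -[leqLHS]muln1; apply: leq_mul; last by rewrite muln_gt0 n_gt0.
  rewrite expnMn; apply: leq_trans (leq_mul t2 (leqnn _)) _; rewrite -mulnA.
  apply: leq_mul; first exact: leq_trans c16_le.
  by rewrite -expnS leq_pexp2l.
have L0 : (0 < L)%N by apply: leq_trans s_le_L.
have m_gt0 : (0 < m)%N by rewrite mE muln_gt0 t0.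
have m_le : (m ^ 2 <= 4 * X)%N.
  have L1 : (1 < L)%N by apply: leq_trans s_le_L.
  have L_le : (L <= 2 * L.-1)%N by rewrite -{1}(prednK L0) mul2n -addnn -addn1 leq_add2l -ltnS prednK.
  have lt_X : ((t * L.-1) ^ 2 < X)%N.
    by rewrite ltnNge; apply/negP => /L_min; rewrite -ltnS prednK // ltnn.
  apply: leq_trans (_ : (2 * (t * L.-1)) ^ 2 <= _)%N.
    by rewrite leq_exp2r // mE mulnCA leq_mul2l L_le orbT.
  by rewrite expnMn leq_mul2l ltnW.
(* From here on, [z] is all that has to be compared with [r]. *)
have zn : (m ^ 2 <= z * n)%N.
  by apply: leq_trans m_le _; rewrite XE zE !mulnA -[leqLHS]mulnAC.
have sp : ((r * m) ^ 16 <= M ^ 14)%N := spread_bound r0 r_le zr zn nM.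
have rm_M : (r * m <= M)%N.
  by rewrite -(@leq_exp2r _ _ 16) //; apply: leq_trans sp _; rewrite leq_pexp2l.
have m_le_M : (m <= M)%N by apply: leq_trans rm_M; rewrite leq_pmull.
have L_le_m : (L <= m)%N by rewrite mE leq_pmull.
have lg_le_r : (lg <= r)%N by apply: leq_trans z_le_r.
have M_lg : (M <= 2 ^ lg)%N by apply: leq_trans n_lg.
have r4_m : (r ^ 4 <= m)%N.
  rewrite -(@leq_exp2r _ _ 2) // -expnM; apply: leq_trans r_le _.
  apply: leq_trans (_ : X <= _)%N; last by rewrite mE.
  by rewrite XE mulnAC leq_pmull // muln_gt0 lg_gt0 andbT muln_gt0 c34_gt0 expn_gt0 s0.
(* Eight times the mean number of blocks through a point, and of points in a
   block; the mean of the former is exactly [2 * s * t * lg] *)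
pose ad := (16 * s * t * lg)%N.
pose ab := (8 * (M * s %/ L).+1)%N.
have [h hE] : exists h, h = (c12 * s ^ 2 * t ^ 2)%N by exists (c12 * s ^ 2 * t ^ 2)%N.
(* Two points are both present in a block with probability [(s / L) ^ 2], so
   that [phi] close pairs contribute at most 1/16 on average *)
pose phi := (L ^ 2 %/ (16 * s ^ 2))%N.
have ab_ge : (8 * M * s <= ab * L)%N.
  by rewrite /ab -!mulnA leq_mul2l ltnW ?orbT // ltn_ceil.
have ab_le : (ab * L <= 16 * (M * s))%N.
  have -> : (16 * (M * s) = 8 * (M * s + M * s))%N by rewrite addnn -mul2n [RHS]mulnA.
  rewrite /ab -mulnA.
  rewrite leq_mul2l mulSn leq_add ?orbT ?leq_divM //.
  by apply: leq_trans L_le_m (leq_trans m_le_M _); rewrite leq_pmulr.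
have h_gt0 : (0 < h)%N by rewrite hE muln_gt0 expn_gt0 t0 andbT muln_gt0 c12_gt0 expn_gt0 s0.
have ge1 k : (0 < k)%N -> 1 <= k%:R :> F by rewrite ler1n.
have [s1R t1R l1R n1R] : [/\ 1 <= s%:R :> F, 1 <= t%:R :> F, 1 <= lg%:R :> F & 1 <= n%:R :> F].
  by split; apply: ge1.
have [r1R L1R M1R] : [/\ 1 <= r%:R :> F, 1 <= L%:R :> F & 1 <= M%:R :> F].
  by split; apply: ge1.
have ab0R : 0 <= ab%:R :> F by [].
have t2R : t%:R ^+ 2 <= 16 * s%:R :> F by rewrite -natrX -natrM ler_nat.
have MrR : M%:R * r%:R <= 2 * n%:R :> F by rewrite -!natrM ler_nat.
have mER : m%:R = t%:R * L%:R :> F by rewrite mE natrM.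
have abLR : ab%:R * L%:R <= 16 * (M%:R * s%:R) :> F by rewrite -!natrM ler_nat.
have XR : 2 ^+ 34 * s%:R ^+ 6 * n%:R * lg%:R <= m%:R ^+ 2 :> F.
  by rewrite -c34E -!natrX -!natrM ler_nat -XE mE.
have hER : h%:R = 2 ^+ 12 * s%:R ^+ 2 * t%:R ^+ 2 :> F by rewrite -c12E -!natrX -!natrM hE.
have zER : z%:R = 2 ^+ 36 * s%:R ^+ 6 * lg%:R :> F.
  have -> : 2 ^+ 36 = 4 * c34%:R :> F by rewrite c34E; ring.
  by rewrite -!natrX -!natrM zE.
have zrR : z%:R <= r%:R :> F by rewrite ler_nat.
have z2rR : z%:R ^+ 2 <= r%:R :> F by rewrite -natrX ler_nat.
have r4R : r%:R ^+ 4 <= m%:R :> F by rewrite -natrX ler_nat.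
have adR : ad%:R = 16 * s%:R * t%:R * lg%:R :> F by rewrite -!natrM.
have hD : (4 * h * (ad * ab * (8 * r)) <= m)%N.
  have := degree_bound s1R t1R l1R n1R r1R L1R t2R MrR mER abLR XR hER.
  by rewrite -adR -!natrM ler_nat -mulnA.
have hphi : (h * h * (m * (8 * r) + m * (ad * ab * (8 * r))) + 2 * (40 * h) * m ^ 2 <= h * h * phi)%N.
  have hDR : 4 * h%:R * (ad * ab * (8 * r))%:R <= m%:R :> F by rewrite -!natrM ler_nat.
  have phiR : L%:R ^+ 2 <= 16 * s%:R ^+ 2 * (phi%:R + 1) :> F.
    have s2_gt0 : (0 < 16 * s ^ 2)%N by rewrite muln_gt0 expn_gt0 s0.
    have phiN : (L ^ 2 <= 16 * s ^ 2 * phi.+1)%N.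
      rewrite mulnC; exact: ltnW (ltn_ceil _ s2_gt0).
    rewrite -!natrX.
    rewrite natr1.
    rewrite -!natrM.
    rewrite ler_nat.
    exact: phiN.
  have := close_pairs_bound s1R t1R L1R mER hER hDR phiR
    (many_rows_slack s1R l1R r1R t2R zER zrR r4R)
    (many_labels_slack s1R t1R l1R n1R t2R mER XR).
  by rewrite -!natrX -!natrM -!natrD -!natrM -natrD ler_nat.
have had : (8 * (2 * m * lg) * s <= ad * L)%N.
  by rewrite /ad mE; apply: eq_leq; ring.
have hreg : M%:R * 2^-1 ^+ ad + (2 * m * lg)%:R * 2^-1 ^+ ab <= 8^-1 :> F.
  rewrite (_ : 8^-1 = 16%:R^-1 + 16%:R^-1 :> F); last by field.
  apply: lerD; apply: natr_halves_le => //.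
    apply: leq_trans (_ : 2 ^ 4 * 2 ^ lg <= _)%N; first by rewrite leq_mul.
    rewrite -expnD leq_pexp2l // /ad.
    have st0 : (0 < s * t)%N by rewrite muln_gt0 s0.
    rewrite -[(16 * s * t)%N]mulnA; exact: degree_exponent_slack.
  have q_ge : (r <= M * s %/ L)%N.
    rewrite leq_divRL //; apply: leq_trans (leq_mul (leqnn r) L_le_m) _.
    by apply: leq_trans rm_M _; rewrite leq_pmulr.
  apply: leq_trans (_ : 2 ^ 5 * (2 ^ lg * 2 ^ lg) <= _)%N.
    rewrite (_ : 16 * (2 * m * lg) = 2 ^ 5 * (m * lg))%N; last by rewrite !mulnA.
    rewrite leq_mul2l leq_mul ?orbT //; first exact: leq_trans m_le_M M_lg.
    by rewrite ltnW // ltn_expl.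
  rewrite -!expnD leq_pexp2l // /ab; exact: size_exponent_slack lg_le_r q_ge.
have hconf : (M ^ (h + h) * (h * h) ^ (40 * h) * M ^ (40 * h))%:R
    * ((ad ^ 2)%:R * (s%:R / L%:R) ^+ 2) ^+ (40 * h) <= 8^-1 :> F.
  pose theta : F := h%:R ^+ 2 * M%:R * (16 * s%:R * t%:R * lg%:R) ^+ 2 * (s%:R / L%:R) ^+ 2.
  have -> : (M ^ (h + h) * (h * h) ^ (40 * h) * M ^ (40 * h))%:R
      * ((ad ^ 2)%:R * (s%:R / L%:R) ^+ 2) ^+ (40 * h) = M%:R ^+ (h + h) * theta ^+ (40 * h).
    rewrite natrM natrM !natrX natrM adR -!mulrA -!exprMn; congr (_ * _ ^+ _).
    by rewrite /theta; ring.
  have ratio := config_ratio_bound s1R t1R l1R n1R L1R t2R MrR mER XR hER zER.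
  apply: (config_bound r1R M1R _ ratio z2rR _ _ h_gt0).
  - exact: mulr_ge0 (mulr_ge0 (mulr_ge0 (sqr_ge0 _) (ler0n _ _)) (sqr_ge0 _)) (sqr_ge0 _).
  - have -> : 2 ^+ 8 * r%:R ^+ 8 = ((2 * r) ^ 8)%:R :> F by rewrite natrX natrM exprMn.
    by rewrite ler_nat; apply: leq_trans M_le_n (ltnW n_lt).
  - by rewrite -c16E ler_nat.
have hunion : n%:R ^+ m * 2^-1 ^+ (2 * m * lg) <= 8^-1 :> F.
  rewrite -natrX; apply: natr_halves_le => //.
  apply: leq_trans (_ : n ^ m * n ^ m <= _)%N.
    rewrite leq_mul2r; apply/orP; right; apply: leq_trans (_ : n ^ 1 <= _)%N.
      by rewrite expn1; apply: leq_trans r_le_n; apply: leq_trans r16; apply: leq_trans c16_ge16.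
    by rewrite leq_pexp2l.
  rewrite -expnD addnn -mul2n [(2 * m * lg)%N]mulnC [leqRHS]expnM leq_exp2r //.
  by rewrite muln_gt0.
have half : s%:R * ((L%:R - 1) / L%:R) ^+ m
      + (phi + phi + m * (ad * ab))%:R * (s%:R / L%:R) ^+ 2 <= 2^-1 :> F.
  have Lp : 0 < L%:R ^+ 2 :> F by rewrite exprn_gt0 // ltr0n.
  have L01 : 0 <= (L%:R - 1) / L%:R :> F by rewrite divr_ge0 // subr_ge0.
  have miss : s%:R * ((L%:R - 1) / L%:R) ^+ m <= 4%:R^-1 :> F.
    apply: le_trans (natr_halves_le F (isT : (0 < 4)%N) st); rewrite ler_wpM2l //.
    rewrite mE mulnC exprM lerXn2r ?nnegrE ?exprn_ge0 ?invr_ge0 //.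
    exact: pow_pred_half.
  have phiN : (16 * phi * s ^ 2 <= L ^ 2)%N.
    by rewrite mulnAC mulnC; apply: leq_divM.
  have dN : (8 * (m * (ad * ab)) * s ^ 2 <= L ^ 2)%N.
    rewrite -(@leq_pmul2r (t ^ 2)) ?expn_gt0 ?t0 // -expnMn [(L * t)%N]mulnC -mE.
    rewrite (_ : 8 * (m * (ad * ab)) * s ^ 2 * t ^ 2 = m * (8 * s ^ 2 * t ^ 2 * (ad * ab)))%N;
      last by ring.
    rewrite -[(m ^ 2)%N]/(m * m)%N leq_mul2l; apply/orP; right; apply: leq_trans hD.
    rewrite (mulnC (ad * ab)%N (8 * r)%N) [leqRHS]mulnA leq_mul2r; apply/orP; right.
    rewrite hE (_ : 4 * (c12 * s ^ 2 * t ^ 2) * (8 * r) = 8 * s ^ 2 * t ^ 2 * (4 * c12 * r))%N;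
      last by ring.
    by rewrite leq_pmulr // !muln_gt0 c12_gt0.
  have phiR : phi%:R * (s%:R / L%:R) ^+ 2 <= 16^-1 :> F.
    by rewrite expr_div_n mulrA ler_pdivrMr // ler_pdivlMl // mulrA -!natrX -!natrM ler_nat.
  have dR : (m * (ad * ab))%:R * (s%:R / L%:R) ^+ 2 <= 8^-1 :> F.
    by rewrite expr_div_n mulrA ler_pdivrMr // ler_pdivlMl // mulrA -!natrX -!natrM ler_nat.
  move: miss phiR dR; rewrite !natrD; clear.
  move: (s%:R * _ ^+ m) phi%:R (m * (ad * ab))%:R ((s%:R / L%:R) ^+ 2) => a b c q.
  by rewrite !mulrDl; move: (b * q) (c * q) => bq cq; lra.
have hspread : M%:R ^+ (2 * m) * ((r * m)%:R / (4 * M%:R)) ^+ (16 * m)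
      + M%:R * 2^-1 ^+ (8 * r) < 1 :> F.
  have Mp : 0 < M%:R :> F by rewrite ltr0n.
  have quarter : M%:R ^+ 2 * ((r * m)%:R / (4 * M%:R)) ^+ 16 <= 4^-1 :> F.
    rewrite expr_div_n mulrA ler_pdivrMr ?exprn_gt0 ?mulr_gt0 //.
    apply: le_trans (_ : M%:R ^+ 2 * M%:R ^+ 14 <= _).
      by rewrite ler_wpM2l ?exprn_ge0 // -!natrX ler_nat.
    rewrite -exprD exprMn mulrA ler_peMl ?exprn_ge0 //.
    have -> : 4^-1 * 4 ^+ 16 = 4 ^+ 15 :> F by field.
    by apply: exprn_ege1; rewrite ler1n.
  have first : M%:R ^+ (2 * m) * ((r * m)%:R / (4 * M%:R)) ^+ (16 * m) <= 4^-1 :> F.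
    rewrite !exprM -exprMn; apply: le_trans (_ : 4^-1 ^+ m <= _).
      have q0 : 0 <= (r * m)%:R / (4 * M%:R) :> F.
        exact: divr_ge0 (ler0n _ _) (mulr_ge0 (ler0n _ 4) (ler0n _ _)).
      have q1 := mulr_ge0 (exprn_ge0 2 (ler0n F M)) (exprn_ge0 16 q0).
      by apply: lerXn2r; rewrite ?nnegrE ?invr_ge0.
    rewrite -[leRHS]expr1; apply: ler_wiXn2l; rewrite ?invr_ge0 //.
    by rewrite invf_le1 ?ltr0n // ler1n.
  have second : M%:R * 2^-1 ^+ (8 * r) <= 2%:R^-1 :> F.
    apply: natr_halves_le => //; apply: leq_trans (_ : 2 * 2 ^ lg <= _)%N.
      by rewrite leq_mul2l M_lg.
    rewrite -expnS leq_pexp2l //; move: lg_le_r r0; clear; lia.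
  by apply: le_lt_trans (lerD first second) _; lra.
exists m, (2 * m * lg)%N, L, M, r, ad, ab, h, (40 * h)%N, phi; split; first by rewrite -XE.
exact: Admissible s_le_L m_gt0 h_gt0 r0 n_gt0 nM hD hphi had ab_ge hreg hconf hunion half hspread.
Qed.
End ParameterChoice.

(** * Conclusion *)

Lemma pow32_le_exp2 (l : nat) : (400 <= l)%N -> (l ^ 32 <= 2 ^ l.-1)%N.
Proof.
move=> l400; have le_l : (l <= 2 ^ 6 * 2 ^ (l %/ 64))%N.
  apply: ltnW; apply: leq_trans (ltn_ceil l (isT : (0 < 64)%N)) _.
  by rewrite mulnC leq_mul2l ltn_expl.
apply: leq_trans (_ : (2 ^ 6 * 2 ^ (l %/ 64)) ^ 32 <= _)%N; first by rewrite leq_exp2r.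
by rewrite -expnD -expnM leq_pexp2l //; lia.
Qed.

(** As [n] is a large power of [s], half of that power absorbs the powers of
    [s] and the rest absorbs the powers of the logarithm. *)
Lemma parameter_le (s n e c : nat) :
  (1 < s)%N -> (1344 <= e)%N -> (s ^ e <= n)%N -> (c <= s ^ 36)%N ->
  [/\ (1 < n)%N, (1 < up_log 2 n)%N & ((c * s ^ 6 * up_log 2 n) ^ 16 <= n)%N].
Proof.
move=> s1 e_ge se_n cs; set l := up_log 2 n.
have s0 : (0 < s)%N by apply: ltnW.
have n2e : (2 ^ e <= n)%N by apply: leq_trans se_n; rewrite leq_exp2r //; apply: leq_trans e_ge.
have n1 : (1 < n)%N.
  apply: leq_trans n2e; rewrite -[leqLHS]/(2 ^ 1)%N leq_exp2l //; exact: leq_trans e_ge.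
case/andP: (up_log_bounds (isT : (1 < 2)%N) n1); rewrite -/l => lo hi.
have e_l : (e <= l)%N by rewrite -(@leq_exp2l 2) // (leq_trans n2e).
have l_n : (l ^ 32 <= n)%N.
  apply: leq_trans (ltnW lo); apply: pow32_le_exp2; apply: leq_trans e_l.
  exact: leq_trans e_ge.
split=> //; first by apply: leq_trans e_l; apply: leq_trans e_ge.
rewrite -(@leq_exp2r _ _ 2) // -expnM.
apply: leq_trans (_ : (s ^ 42 * l) ^ 32 <= _)%N.
  rewrite leq_exp2r // leq_mul2r; apply/orP; right.
  by rewrite (expnD s 36 6) leq_mul2r cs orbT.
rewrite expnMn -expnM -[(n ^ 2)%N]/(n * n)%N; apply: leq_mul => //.
by apply: leq_trans se_n; rewrite leq_pexp2l.
Qed.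

Lemma up_log_le_ln (R : realType) (n : nat) : (1 < n)%N -> (1 < up_log 2 n)%N ->
  (up_log 2 n)%:R <= 4 * ln n%:R :> R.
Proof.
move=> n1 l1; set l := up_log 2 n in l1 *.
case/andP: (up_log_bounds (isT : (1 < 2)%N) n1); rewrite -/l => lo _.
have ln2 : 2^-1 <= ln 2 :> R.
  rewrite -[leLHS]expRK ler_ln ?posrE ?expR_gt0 //.
  have h : 2^-1 <= expR (- 2^-1) :> R.
    by apply: le_trans (expR_ge1Dx _); lra.
  rewrite -[expR _]invrK -expRN -[leRHS]invrK lef_pV2 ?posrE ?expR_gt0 ?invr_gt0 //.
have : l.-1%:R * ln 2 <= ln n%:R :> R.
  rewrite mulr_natl -lnXn // ler_ln ?posrE ?exprn_gt0 ?ltr0n 1?ltnW //.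
  by rewrite -natrX ler_nat ltnW.
have : l%:R <= 2 * l.-1%:R :> R.
  by rewrite -natrM ler_nat; case: (l) l1 => [|[|k]] //= _; lia.
have : 0 <= l.-1%:R :> R by [].
move: (l.-1%:R) (l%:R : R) (ln n%:R) => a b c a0 ba; nra.
Qed.

Theorem theorem3p1 (R : realType) :
  exists C : R, 0 < C /\
    forall s n : nat, (2 <= s)%N -> (s%:R : R) `^ C <= n%:R ->
      exists G : sgraph,
        [/\ #|G| = n,
            free_of (complete_graph s.+1) G &
            forall k : nat, C * s%:R ^+ 3 * Num.sqrt (n%:R * ln n%:R) <= k%:R ->
              forall S : {set G}, #|S| = k ->
                contains_copy (induced_subgraph S) (complete_graph s)].
Proof.
(* [16 * m] is at most [2 ^+ 23 * s ^+ 3] times the root in the statement, where the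
   base 2 logarithm costs a factor 2 after taking roots; as an exponent of
   [s] the same constant exceeds 1344, as [parameter_le] requires. *)
exists (2 ^+ 24); split=> [|s n s1 le_n]; first by rewrite exprn_gt0.
have s1R : 1 <= s%:R :> R by rewrite ler1n ltnW.
have se_n : (s ^ 1344 <= n)%N.
  rewrite -(ler_nat R) natrX -powR_mulrn //; apply: le_trans le_n.
  apply: ler_powR => //; lra.
have power k : exists c, forall u : unit, c = (2 ^ k)%N by exists (2 ^ k)%N.
have [c12 c12E] := power 12; have [c16 c16E] := power 16; have [c34 c34E] := power 34.
have c_s : (4 * c34 <= s ^ 36)%N.
  have -> : (4 * c34 = 2 ^ 36)%N by rewrite (c34E tt); exact: (esym (expnD 2 2 34)).
  by rewrite leq_exp2r.
have [n1 lg1 z_le] := parameter_le s1 (leqnn _) se_n c_s.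
have [m [N [L [M [r [ad [ab [h [v [phi [m2 adm]]]]]]]]]]] : exists m N L M r ad ab h v phi,
    (m ^ 2 <= 4 * (c34 * s ^ 6 * n * up_log 2 n))%N /\
    admissible rat s n N L M m r ad ab h v phi.
  have c16_ge : (16 <= c16)%N by rewrite (c16E tt) -[leqLHS]/(2 ^ 4)%N leq_pexp2l.
  have c16_le : (c16 <= c34)%N by rewrite (c16E tt) (c34E tt) leq_pexp2l.
  have c12_gt : (0 < c12)%N by rewrite (c12E tt) expn_gt0.
  apply: (exists_admissible s1 c16_ge c16_le c12_gt _ _ _ z_le (ltnW lg1)).
  - rewrite (c12E tt); exact: natrX.
  - rewrite (c16E tt); exact: natrX.
  - rewrite (c34E tt); exact: natrX.
have [G [cardG freeG sparseG]] := two_system_graph_exists s1 adm.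
exists G; split=> // k le_k S cardS; apply: sparseG; rewrite cardS -(ler_nat R).
apply: le_trans le_k.
have ln0 : 0 <= ln n%:R :> R by rewrite ln_ge0 // ler1n ltnW.
have nln0 : 0 <= n%:R * ln n%:R :> R by rewrite mulr_ge0.
rewrite -ler_sqr ?nnegrE ?mulr_ge0 ?exprn_ge0 ?sqrtr_ge0 //.
rewrite exprMn sqr_sqrtr //.
have m2R : m%:R ^+ 2 <= 2 ^+ 36 * s%:R ^+ 6 * n%:R * (up_log 2 n)%:R :> R.
  have -> : 2 ^+ 36 = 4 * c34%:R :> R by rewrite (c34E tt) natrX; ring.
  by rewrite -!mulrA -!natrX -!natrM ler_nat !mulnA; move: m2; rewrite !mulnA.
have A0 : 0 <= s%:R ^+ 6 * n%:R :> R by rewrite mulr_ge0 ?exprn_ge0.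
apply: le_trans (_ : 2 ^+ 8 * (2 ^+ 36 * s%:R ^+ 6 * n%:R * (4 * ln n%:R)) <= _).
  have -> : (16 * m)%:R ^+ 2 = 2 ^+ 8 * m%:R ^+ 2 :> R by rewrite natrM; ring.
  rewrite ler_wpM2l ?exprn_ge0 //; apply: le_trans m2R _.
  by rewrite -!mulrA !ler_wpM2l ?exprn_ge0 // up_log_le_ln.
have -> : 2 ^+ 8 * (2 ^+ 36 * s%:R ^+ 6 * n%:R * (4 * ln n%:R)) =
  2 ^+ 46 * (s%:R ^+ 6 * n%:R * ln n%:R) :> R by ring.
have -> : (2 ^+ 24 * s%:R ^+ 3) ^+ 2 * (n%:R * ln n%:R) =
  2 ^+ 48 * (s%:R ^+ 6 * n%:R * ln n%:R) :> R by ring.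
rewrite ler_wpM2r //; first by rewrite mulr_ge0.
by rewrite ler_weXn2l // ler1n.
Qed.
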